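(* Let $n\ge 1$. The triple $$\left(\mathrm{NCC}(n+1),\ \langle\mathrm{twist}_{2n}\rangle,\ \begin{bmatrix} 2n\\ n\end{bmatrix}_q-q^2\begin{bmatrix} 2n\\ n-2\end{bmatrix}_q\right)$$ exhibits the cyclic sieving phenomenon, where $\langle\mathrm{twist}_{2n}\rangle$ is regarded as an action of the cyclic group of order $2n$.
   Context: Cyclic sieving: let $X$ be a finite set, $C_N$ a cyclic group of order $N$ with generator $g$ acting on $X$, and $f(q)$ a polynomial with non-negative integer coefficients. The triple $(X,C_N,f(q))$ exhibits the cyclic sieving phenomenon if for all $d\in\mathbb Z$, $|\{x\in X: g^d\cdot x=x\}|=f(\xi^d)$, where $\xi$ is a primitive $N$-th complex root of unity. $\begin{bmatrix} m\\ r\end{bmatrix}_q$ is the Gaussian $q$-binomial coefficient, equal to $0$ unless $m\ge r\ge 0$. $\mathrm{NCC}(n+1)$ is the set of non-crossing $(1,2)$-configurations on $n$ vertices: place vertices $1,\dots,n$ around a circle; a configuration consists of a set of pairwise non-intersecting proper edges (chords joining two distinct vertices, pairwise non-crossing and not sharing endpoints) together with a set of loops, each loop placed on a vertex not incident to a proper edge (at most one loop per vertex). A vertex with a loop is called marked. $\mathrm{rot}_n$ rotates a configuration by one step, $i\mapsto i+1\pmod n$. The flip $\gamma$ removes the loop at vertex $1$ if there is one, adds a loop at vertex $1$ if vertex $1$ has neither a loop nor a proper edge, and does nothing if vertex $1$ is incident to a proper edge. $\mathrm{twist}_{2n}:=\mathrm{rot}_n\circ\gamma$; it satisfies $\mathrm{twist}_{2n}^{2n}=\mathrm{id}$.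 *)

(* Defs.v *)
From HB Require Import structures.
From mathcomp Require Import all_boot all_order all_algebra.
From mathcomp Require Import all_fingroup all_solvable all_field.
From mathcomp Require Import ring zify.

Set Implicit Arguments.
Unset Strict Implicit.
Unset Printing Implicit Defensive.

Import Order.TTheory GRing.Theory Num.Theory.

Local Open Scope ring_scope.

Definition expgz (gT : finGroupType) (g : gT) (d : int) : gT :=
  match d with
  | Posz k => (g ^+ k)%g
  | Negz k => (g ^- k.+1)%g
  end.

(* The first two clauses say that [to] is an action of a cyclic group of order
   [N] with generator [g]. All complex roots of unity are in [algC]. *)
Definition cyclic_sieving (gT : finGroupType) (G : {group gT}) (X : finType)
    (to : action G X) (g : gT) (N : nat) (f : {poly int}) : Prop :=
  [/\ G = <[g]>%g :> {set gT},
      #[g]%g = N,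
      forall i : nat, 0 <= f`_i
    & forall xi : algC, N.-primitive_root xi ->
      forall d : int,
        #|('Fix_to[expgz g d])%g|%:R = (map_poly intr f).[xi ^ d] ].

Definition qint (k : nat) : {poly int} := \sum_(i < k) 'X^i.

Definition qfact (k : nat) : {poly int} := \prod_(i < k) qint i.+1.

(* The lower index may be negative. The divisor is monic, so [%/] is Euclidean
   division in Z[q]; it is exact by [qbinom_fact]. *)
Definition qbinom (m r : int) : {poly int} :=
  if (0 <= r) && (r <= m)
  then qfact `|m| %/ (qfact `|r| * qfact `|m - r|)
  else 0.

Lemma qintD (a b : nat) : qint (a + b) = qint a + 'X^a * qint b.
Proof.
rewrite /qint big_split_ord /=; congr (_ + _).
by rewrite mulr_sumr; apply: eq_bigr => i _; rewrite exprD.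
Qed.

Lemma qfactS (k : nat) : qfact k.+1 = qfact k * qint k.+1.
Proof. by rewrite /qfact big_ord_recr. Qed.

Lemma qint_monic (k : nat) : qint k.+1 \is monic.
Proof.
have -> : qint k.+1 = \poly_(i < k.+1) 1.
  by rewrite poly_def; apply: eq_bigr => i _; rewrite scale1r.
by rewrite monicE lead_coef_poly // oner_eq0.
Qed.

Lemma qfact_monic (k : nat) : qfact k \is monic.
Proof. by apply: monic_prod => i _; apply: qint_monic. Qed.

Lemma qfact_dvd (a b : nat) :
  exists p : {poly int}, qfact (a + b) = p * (qfact a * qfact b).
Proof.
elim: a b => [|a IHa] b; first by exists 1; rewrite /qfact big_ord0 !mul1r.
elim: b => [|b [p Hp]].
  by exists 1; rewrite addn0 {3}/qfact big_ord0 mulr1 mul1r.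
have [r Hr] := IHa b.+1.
exists (r + 'X^(a.+1) * p).
have E1 : qfact (a.+1 + b.+1) = qfact (a + b.+1) * qint (a.+1 + b.+1).
  by rewrite addSn qfactS.
have E2 : qfact (a + b.+1) = p * (qfact a.+1 * qfact b).
  by rewrite -Hp addSnnS.
rewrite E1 qintD mulrDr {1}Hr E2 (qfactS a) (qfactS b).
ring.
Qed.

Lemma qbinom_fact (m r : nat) : (r <= m)%N ->
  qbinom m r * (qfact r * qfact (m - r)) = qfact m.
Proof.
move=> le_rm; rewrite /qbinom lez_nat le_rm /=.
have -> : `|m%:Z - r%:Z|%N = (m - r)%N by rewrite subzn.
have [p] := qfact_dvd r (m - r); rewrite subnKC // => ->.
have mon : qfact r * qfact (m - r) \is monic.
  by rewrite monicMl qfact_monic.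
by rewrite (Pdiv.IdomainMonic.mulpK mon).
Qed.

(* In [(E, L)], [E] is the set of proper edges and [L] the set of marked
   vertices; the vertices 1, ..., n are numbered 0, ..., n - 1. *)
Definition config (n : nat) : Type := ({set {set 'I_n}} * {set 'I_n})%type.

(* A chord [e] has an endpoint strictly between those of [e'], and conversely;
   the order a < b < c < d is no restriction up to exchanging [e] and [e']. *)
Definition cross (n : nat) (e e' : {set 'I_n}) : bool :=
  [exists a in e, [exists b in e', [exists c in e, [exists d in e',
    [&& (a < b)%N, (b < c)%N & (c < d)%N]]]]].

Definition is_ncc (n : nat) (c : config n) : bool :=
  [&& [forall e : {set 'I_n} in c.1, #|e| == 2%N],
      trivIset c.1,
      [forall e : {set 'I_n} in c.1, forall e' : {set 'I_n} in c.1,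
         ~~ cross e e']
    & [disjoint c.2 & cover c.1]].

(* These configurations on [n] vertices form the set usually written NCC(n+1):
   there are Catalan(n+1) of them. *)
Record ncc (n : nat) := NCC { ncc_val :> config n; _ : is_ncc ncc_val }.

HB.instance Definition _ (n : nat) := [isSub for @ncc_val n].
HB.instance Definition _ (n : nat) := [Finite of ncc n by <:].

Definition flip_config (n : nat) (c : config n) : config n :=
  (c.1, [set v : 'I_n | if (v == 0%N :> nat) && (v \notin cover c.1)
                        then v \notin c.2 else v \in c.2]).

Definition rot_config (n : nat) (c : config n) : config n :=
  ([set @ordS n @: e | e : {set 'I_n} in c.1], @ordS n @: c.2).

Lemma flip_is_ncc (n : nat) (c : ncc n) : is_ncc (flip_config c).
Proof.
case: c => -[E L] /= /and4P[h1 h2 h3 h4].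
apply/and4P; split=> //=.
rewrite disjoint_subset; apply/subsetP => v; rewrite !inE /=.
case: (boolP (v \in cover E)) => // vE; rewrite andbF => vL.
by move/disjointFr: h4 => /(_ _ vL); rewrite vE.
Qed.

Lemma cover_rot (n : nat) (E : {set {set 'I_n}}) :
  cover [set @ordS n @: e | e : {set 'I_n} in E] = @ordS n @: cover E.
Proof.
apply/setP => v; apply/bigcupP/imsetP.
  move=> [_ /imsetP[e eE ->] /imsetP[w we ->]].
  by exists w => //; apply/bigcupP; exists e.
move=> [w /bigcupP[e eE we] ->].
by exists (@ordS n @: e); apply: imset_f.
Qed.

Lemma ordS_valE (n : nat) (i : 'I_n) :
  (ordS i = i.+1 :> nat) \/ (ordS i = 0%N :> nat /\ i.+1 = n).
Proof.
rewrite /=; have := ltn_ord i; rewrite leq_eqVlt => /orP[/eqP h|h].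
  by right; rewrite h modnn.
by left; rewrite modn_small.
Qed.

Lemma rot_is_ncc (n : nat) (c : ncc n) : is_ncc (rot_config c).
Proof.
case: c => -[E L] /= /and4P[/= h1 h2 h3 h4].
have inj := @ordS_inj n.
apply/and4P; split=> /=.
- apply/forall_inP => _ /imsetP[e eE ->].
  by rewrite card_imset //; apply: (forall_inP h1).
- apply/trivIsetP => _ _ /imsetP[e eE ->] /imsetP[e' eE' ->] ne.
  have ne' : e != e' by apply: contraNneq ne => ->.
  rewrite imset_disjoint //; exact: (trivIsetP h2).
- have H e e' (a b c d : 'I_n) : e \in E -> e' \in E ->
      a \in e -> b \in e' -> c \in e -> d \in e' ->
      (a < b)%N -> (b < c)%N -> (c < d)%N -> False.
    move=> eE eE' ae be' ce de' ab bc cd.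
    move/forall_inP: h3 => /(_ _ eE)/forall_inP/(_ _ eE')/negP; apply.
    apply/exists_inP; exists a => //; apply/exists_inP; exists b => //.
    apply/exists_inP; exists c => //; apply/exists_inP; exists d => //.
    by rewrite ab bc.
  apply/forall_inP => _ /imsetP[e eE ->].
  apply/forall_inP => _ /imsetP[e' eE' ->].
  apply/negP => /exists_inP[_ /imsetP[a ae ->]].
  move=> /exists_inP[_ /imsetP[b be' ->]].
  move=> /exists_inP[_ /imsetP[c ce ->]].
  move=> /exists_inP[_ /imsetP[d de' ->]] /and3P[ab bc cd].
  have la := ltn_ord a; have lb := ltn_ord b.
  have lc := ltn_ord c; have ld := ltn_ord d.
  case: (ordS_valE a) (ordS_valE b) (ordS_valE c) (ordS_valE d)
    => [Sa|[Sa an]] [Sb|[Sb bn]] [Sc|[Sc cn]] [Sd|[Sd dn]];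
  rewrite Sa Sb in ab; rewrite Sb Sc in bc; rewrite Sc Sd in cd;
  try by [lia].
    exact: (H e e' a b c d).
  have lSd := ltn_ord (ordS d); rewrite Sd in lSd.
  by apply: (H e' e b c d a) => //; rewrite -ltnS an.
- by rewrite cover_rot imset_disjoint.
Qed.

Definition flip (n : nat) (c : ncc n) : ncc n := NCC (flip_is_ncc c).

Definition rot (n : nat) (c : ncc n) : ncc n := NCC (rot_is_ncc c).

Definition twist (n : nat) (c : ncc n) : ncc n := rot (flip c).

Lemma ncc_eqP (n : nat) (c c' : ncc n) :
  (forall e, (e \in (ncc_val c).1) = (e \in (ncc_val c').1)) ->
  (forall v, (v \in (ncc_val c).2) = (v \in (ncc_val c').2)) -> c = c'.
Proof.
move=> h1 h2; apply: val_inj => /=.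
case: c c' h1 h2 => -[E L] ? [[E' L'] ?] /= h1 h2.
by congr (_, _); apply/setP.
Qed.

Lemma iter_twist (n k : nat) (c : ncc n) :
  [/\ (ncc_val (iter k (@twist n) c)).1
        = [set iter k (@ordS n) @: (e : {set 'I_n}) | e in (ncc_val c).1],
      forall u, (iter k (@ordS n) u \in cover (ncc_val (iter k (@twist n) c)).1)
        = (u \in cover (ncc_val c).1)
    & forall u, (iter k (@ordS n) u \in (ncc_val (iter k (@twist n) c)).2)
        = (u \in (ncc_val c).2) (+) ((u \notin cover (ncc_val c).1) &&
            \big[addb/false]_(j < k) (iter j (@ordS n) u == 0%N :> nat)) ].
Proof.
have inj := @ordS_inj n.
elim: k => [|k [IH1 IH2 IH3]]; split.
- rewrite /=; apply/setP => e; apply/idP/imsetP => [eE|[e' eE ->]].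
    by exists e; rewrite ?imset_id.
  by rewrite imset_id.
- by [].
- by move=> u; rewrite big_ord0 andbF addbF.
- rewrite iterS /= IH1 -imset_comp; apply: eq_imset => e /=.
  by rewrite -imset_comp.
- by move=> u; rewrite !iterS /= cover_rot mem_imset.
- move=> u; rewrite big_ord_recr /= mem_imset // inE IH2 IH3.
  case: (u \in cover _); first by rewrite andbF.
  case: (u \in _); case: (\big[_/_]_(_ < _) _) => /=;
  by rewrite andbT; case: (_ == _).
Qed.

Lemma iter_ordS (n k : nat) (u : 'I_n) :
  iter k (@ordS n) u = ((u + k) %% n)%N :> nat.
Proof.
elim: k => [|k IHk]; first by rewrite addn0 modn_small.
by rewrite iterS /= IHk -addn1 modnDml addn1 addnS.
Qed.

Lemma twist_order (n : nat) (c : ncc n) : iter (2 * n) (@twist n) c = c.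
Proof.
have ordSid : iter (2 * n) (@ordS n) =1 id.
  by move=> u; apply: val_inj; rewrite /= iter_ordS addnC modnMDl modn_small.
have [h1 _ h3] := iter_twist (2 * n) c.
apply: ncc_eqP => [e|v].
  rewrite h1; apply/imsetP/idP => [[e' eE ->]|eE].
    by rewrite (eq_imset _ ordSid) imset_id.
  by exists e => //; rewrite (eq_imset _ ordSid) imset_id.
rewrite -{1}(ordSid v) h3 mul2n -addnn big_split_ord /=.
rewrite [X in _ && (_ (+) X)](eq_bigr (fun j : 'I_n => iter j (@ordS n) v == 0 :> nat)).
  by rewrite addbb andbF addbF.
by move=> j _; rewrite !iter_ordS addnCA modnDl.
Qed.

Lemma twist_order_Zp (n : nat) (c : ncc n) :
  iter (Zp_trunc (2 * n)).+2 (@twist n) c = c.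
Proof.
case: n c => [|n] c; last by rewrite Zp_cast ?twist_order // mul2n.
have noedge (c' : ncc 0) e : (e \in (ncc_val c').1) = false.
  apply/negP; case: c' => c' /= /and4P[/forall_inP h _ _ _] /h.
  by have := max_card e; rewrite card_ord leqn0 => /eqP ->.
by apply: ncc_eqP => [e|[]//]; rewrite !noedge.
Qed.

Definition twist_pow (n : nat) (c : ncc n) (k : 'Z_(2 * n)) : ncc n :=
  iter k (@twist n) c.

Lemma twist_pow1 (n : nat) : (@twist_pow n)^~ 1%g =1 id.
Proof. by []. Qed.

Lemma twist_powM (n : nat) (c : ncc n) : act_morph (@twist_pow n) c.
Proof.
move=> a b; rewrite /twist_pow -iterD.
have iter_mul m : iter (m * (Zp_trunc (2 * n)).+2) (@twist n) c = c.
  by elim: m => // m IHm; rewrite mulSn iterD IHm twist_order_Zp.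
rewrite [in RHS](divn_eq (b + a) (Zp_trunc (2 * n)).+2) addnC iterD iter_mul.
by rewrite addnC.
Qed.

(* The additive group Z/(2n) acting on configurations, with 1 acting as [twist]. *)
Definition twist_action (n : nat) : {action 'Z_(2 * n) &-> ncc n} :=
  TotalAction (@twist_pow1 n) (@twist_powM n).

Lemma twist_action1 (n : nat) (c : ncc n) : twist_action n c 1%R = twist c.
Proof. by []. Qed.

(* Main.v *)
Require Import Defs.
From HB Require Import structures.
From mathcomp Require Import all_boot all_order all_algebra.
From mathcomp Require Import all_fingroup all_solvable all_field.
From mathcomp Require Import ring zify.

(** Fix [d], put [D = gcd(d, 2n)] and [e = 2n / D]; the twist to the power [d]
    has the same fixed configurations as the twist to the power [D], and
    [xi ^ d] is a primitive [e]-th root of unity.  Both sides of the sieving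
    identity are computed for every such [D].

    The polynomial.  By the q-Lucas theorem [qbinom_lucas], a Gaussian
    coefficient with upper index [D e], evaluated at a primitive [e]-th root of
    unity, is zero or an ordinary binomial coefficient with upper index [D].
    The second term [q^2 [2n, n-2]] contributes only for [e] in [{1, 2, 4}].

    The configurations.  Encode a configuration as a two-letter word [b] of
    period [2n].  At an endpoint of an edge, [b t] and [b (t + n)] agree and tell
    whether the edge opens or closes there; at an uncovered vertex they differ,
    and [b t] tells whether the vertex is marked, up to the parity of the number
    of turns around the circle.  A twist then is a shift of [b],
    so that [b] has period [D] when the configuration is fixed.  The height of
    [b], the partial sum of [b t + b (t + n) - 1], recovers the edges by matching
    parentheses: [i < j] are joined when the height is the same before [i] and
    after [j], and larger in between.  What remains is to choose which end of
    each edge opens, and to determine the words obtained.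

    - For [e <= 2] the rotation part is trivial and edges open at their smaller
      endpoint.  The words are those whose height ends at [0] on [0, n) without
      becoming negative; the reflection principle, in the form of a recursion
      ([paths_full], [paths_loopless]), counts them.
    - For [e >= 3] the edges are invariant under a nontrivial rotation by [h].
      An edge cannot cross its translate, so it is a diameter or spans fewer
      than [h] steps on exactly one side, and this orients it equivariantly.
      The words are those of period [D] with as many true letters as false ones.
      When [e = 4] and [D] is odd there is one diameter; both of its ends open,
      and the words have one true letter in excess.

    The matchings with a diameter are thus what the second Gaussian coefficient
    counts at a primitive fourth root of unity, where [q^2 = -1].

    Finally the coefficients are nonnegative because the polynomial is
    [B(n, n) + q B(n + 1, n - 1)] with
    [B(a, b) = [a + b, b] - q [a + b, b - 1]], and [B(a, b) - B(a, b - 1)] is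
    nonnegative by an induction on [a] ([qballot_mono]). *)

Set Implicit Arguments.
Unset Strict Implicit.
Unset Printing Implicit Defensive.

Import Order.TTheory GRing.Theory Num.Theory.

Local Open Scope ring_scope.

(** * Gaussian coefficients and nonnegativity *)
Lemma qfact_lreg k : GRing.lreg (qfact k).
Proof. by apply: monic_lreg; apply: qfact_monic. Qed.

Lemma qbinom_small (m r : nat) : (m < r)%N -> qbinom m r = 0.
Proof. by move=> h; rewrite /qbinom lez_nat leqNgt h. Qed.

Lemma qbinom0 (m : nat) : qbinom m 0%N = 1.
Proof.
have := @qbinom_fact m 0 (leq0n m).
rewrite subn0 [qfact 0]big_ord0 mul1r => h.
by apply: (@qfact_lreg m); rewrite mulr1 mulrC.
Qed.

(** Indexing by the numbers of the two letters makes the symmetry and both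
    Pascal rules uniform, free of truncated subtractions. *)
Definition gauss (a b : nat) : {poly int} := qbinom (a + b)%N b.

Lemma gauss_fact a b : qfact a * (qfact b * gauss a b) = qfact (a + b).
Proof.
by rewrite -(@qbinom_fact (a + b) b (leq_addl _ _)) addnK /gauss; ring.
Qed.

Lemma gaussC a b : gauss a b = gauss b a.
Proof.
apply: (@qfact_lreg b); apply: (@qfact_lreg a).
by rewrite gauss_fact mulrCA gauss_fact addnC.
Qed.

Lemma gauss0 a : gauss a 0 = 1.
Proof. exact: qbinom0. Qed.

Lemma gaussS a b : gauss a.+1 b.+1 = gauss a.+1 b + 'X^(b.+1) * gauss a b.+1.
Proof.
apply: (@qfact_lreg b.+1); apply: (@qfact_lreg a.+1).
have -> : qfact a.+1 * (qfact b.+1 * gauss a.+1 b.+1) =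
    qfact (a.+1 + b) * qint (b.+1 + a.+1).
  by rewrite gauss_fact addnS qfactS (addnC b.+1) addnS.
rewrite qintD.
have e1 : qfact (a.+1 + b) = qfact a.+1 * (qfact b * gauss a.+1 b) by rewrite gauss_fact.
have e2 : qfact (a.+1 + b) = qfact a * (qfact b.+1 * gauss a b.+1).
  by rewrite gauss_fact addSnnS.
rewrite mulrDr {1}e1 e2 !qfactS; ring.
Qed.

Lemma gaussS_dual a b : gauss a.+1 b.+1 = 'X^(a.+1) * gauss a.+1 b + gauss a b.+1.
Proof. by rewrite gaussC gaussS addrC (gaussC b) (gaussC _ a). Qed.

Lemma gauss_absorb a b :
  ('X^(a.+1) - 1) * gauss a.+1 b = ('X^(a.+1 + b) - 1) * gauss a b.
Proof.
case: b => [|b]; first by rewrite !gauss0 addn0.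
have h1 := gaussS a b; have h2 := gaussS_dual a b.
by rewrite mulrBl mul1r {1}h1 h2 exprD; ring.
Qed.

(** The two Pascal rules combine into the recursion satisfied by the major
    index distribution of words, split by the last two letters. *)
Lemma gauss_rec a b : gauss a.+1 b.+1 =
  gauss a b.+1 + gauss a.+1 b + ('X^(a.+1 + b) - 1) * gauss a b.
Proof. by rewrite -gauss_absorb gaussS_dual; ring. Qed.

(** Generating function by valley major index of the ballot words with [a] up
    steps and [b <= a] down steps, in the closed form given by reflection. *)
Definition qballot (a b : nat) : {poly int} :=
  gauss a b - if b is b'.+1 then 'X * gauss a.+1 b' else 0.

Lemma qballot_rec a b : qballot a.+1 b.+1 =
  qballot a b.+1 + qballot a.+1 b + ('X^(a.+1 + b) - 1) * qballot a b.
Proof.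
rewrite /qballot; case: b => [|b]; first by rewrite gauss_rec !gauss0 !subr0; ring.
rewrite [gauss a.+1 b.+2]gauss_rec [gauss a.+2 b.+1]gauss_rec [(a.+2 + b)%N]addSnnS; ring.
Qed.

(** A ballot word with as many up as down steps ends with a down step. *)
Lemma qballot_diag a : qballot a.+1 a.+1 = qballot a.+1 a.
Proof.
rewrite /qballot; case: a => [|a].
  by rewrite gaussS !gauss0 (gaussC 0) gauss0; ring.
rewrite gaussS [gauss a.+3 a.+1]gaussS (gaussC a.+1) exprS; ring.
Qed.

Definition nonneg (p : {poly int}) := forall i, 0 <= p`_i.

Lemma nonnegD p q : nonneg p -> nonneg q -> nonneg (p + q).
Proof. by move=> hp hq i; rewrite coefD addr_ge0. Qed.

Lemma nonnegXnM k p : nonneg p -> nonneg ('X^k * p).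
Proof. by move=> hp i; rewrite coefXnM; case: ifP. Qed.

Lemma nonneg1 : nonneg 1.
Proof. by move=> i; rewrite coefC; case: ifP. Qed.

(** The difference counts the ballot words ending with an up step: these are
    the words of [(a, b + 1)] with a step added, where adding it after a down
    step creates a valley of weight [a + b + 1].  Subtraction disappears from the
    recursion, hence the nonnegativity. *)
Lemma qballot_mono a : (forall b, (b <= a)%N -> nonneg (qballot a b)) /\
  (forall b, (b < a)%N -> nonneg (qballot a b.+1 - qballot a b)).
Proof.
elim: a => [|a [IH0 IH1]].
  split=> // b; rewrite leqn0 => /eqP->; rewrite /qballot gauss0 subr0; exact: nonneg1.
have IH1' b : (b < a.+1)%N -> nonneg (qballot a.+1 b.+1 - qballot a.+1 b).
  rewrite ltnS leq_eqVlt => /orP[/eqP->|ltba].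
    by rewrite qballot_diag subrr => i; rewrite coef0.
  have -> : qballot a.+1 b.+1 - qballot a.+1 b =
      (qballot a b.+1 - qballot a b) + 'X^(a.+1 + b) * qballot a b by rewrite qballot_rec; ring.
  by apply: nonnegD; [apply: IH1 | apply/nonnegXnM/IH0/ltnW].
split=> //; elim=> [|b IHb] hb.
  by rewrite /qballot gauss0 subr0; apply: nonneg1.
rewrite -(subrK (qballot a.+1 b) (qballot a.+1 b.+1)).
by apply: nonnegD; [apply: IH1' | apply/IHb/ltnW].
Qed.

Lemma sieve_ge0 n : (1 <= n)%N ->
  nonneg (qbinom (2 * n)%N n - 'X^2 * qbinom (2 * n)%N (n%:Z - 2)).
Proof.
case: n => // -[|n] _.
  have -> : qbinom (2 * 1)%N (1%:Z - 2) = 0 by [].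
  rewrite mulr0 subr0.
  have -> : qbinom (2 * 1)%N 1%N = qballot 1 0 + 'X^1 * 1.
    by rewrite -[qbinom _ _]/(gauss 1 1) gaussS /qballot !gauss0 (gaussC 0) gauss0; ring.
  by apply: nonnegD; [apply: (qballot_mono _).1 | apply/nonnegXnM/nonneg1].
have -> : n.+2%:Z - 2 = n by lia.
have -> : qbinom (2 * n.+2)%N n.+2 = gauss n.+2 n.+2 by rewrite mul2n -addnn.
have -> : qbinom (2 * n.+2)%N n = gauss n.+4 n.
  by rewrite /gauss; congr (qbinom (Posz _) _); lia.
have -> : gauss n.+2 n.+2 - 'X^2 * gauss n.+4 n =
  qballot n.+2 n.+2 + 'X^1 * qballot n.+3 n.+1 by rewrite /qballot; ring.
by apply: nonnegD; [|apply: nonnegXnM]; apply: (qballot_mono _).1; lia.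
Qed.

(** * Gaussian coefficients at roots of unity *)

Section Lucas.
Variables (e : nat) (w : algC).
Hypothesis pw : e.-primitive_root w.

Let e_gt0 : (0 < e)%N := prim_order_gt0 pw.

Definition qev (p : {poly int}) : algC := (map_poly intr p).[w].

Lemma qevM p q : qev (p * q) = qev p * qev q.
Proof. by rewrite /qev rmorphM hornerM. Qed.
Lemma qevD p q : qev (p + q) = qev p + qev q.
Proof. by rewrite /qev rmorphD hornerD. Qed.
Lemma qevX k : qev 'X^k = w ^+ k.
Proof. by rewrite /qev map_polyXn hornerXn. Qed.
Lemma qev1 : qev 1 = 1.
Proof. by rewrite /qev rmorph1 hornerC. Qed.
Lemma qev0 : qev 0 = 0.
Proof. by rewrite /qev rmorph0 hornerC. Qed.

Lemma qev_qint k : (w - 1) * qev (qint k) = w ^+ k - 1.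
Proof.
have -> : qint k = \sum_(i < k) 'X^i by [].
rewrite /qev rmorph_sum /= horner_sum subrX1; congr (_ * _).
by apply: eq_bigr => i _; rewrite map_polyXn hornerXn.
Qed.

Definition qbinom_at (m r : nat) := qev (qbinom m r).

Lemma qbinom_at0 m : qbinom_at m 0 = 1.
Proof. by rewrite /qbinom_at qbinom0 qev1. Qed.

Lemma qbinom_at_small m r : (m < r)%N -> qbinom_at m r = 0.
Proof. by move=> h; rewrite /qbinom_at qbinom_small // qev0. Qed.

Lemma qbinom_atS m r : qbinom_at m.+1 r.+1 = qbinom_at m r + w ^+ r.+1 * qbinom_at m r.+1.
Proof.
case: (ltngtP m r) => [lt|lt|->].
- by rewrite !qbinom_at_small //; [ring | lia..].
- rewrite -(subnK lt) /qbinom_at.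
  rewrite -[qbinom _.+1 _](_ : gauss (m - r.+1).+1 r.+1 = _); last first.
    by rewrite /gauss addSn.
  by rewrite gaussS qevD qevM qevX /gauss addSnnS.
- by rewrite [qbinom_at r r.+1]qbinom_at_small // mulr0 addr0 /qbinom_at -[LHS]/(qev (gauss 0 _))
    -[RHS]/(qev (gauss 0 _)) !(gaussC 0) !gauss0.
Qed.

(** In the factorial formula the numerator has a factor vanishing at [w], which
    no factor of the denominator does. *)
Lemma qbinom_at_order r : (0 < r < e)%N -> qbinom_at e r = 0.
Proof.
move=> /andP[r0 re].
have h := @qbinom_fact e r (ltnW re).
have nz k : (k < e)%N -> qev (qfact k) != 0.
  elim: k => [|k IHk] hk; first by rewrite [qfact 0]big_ord0 qev1 oner_eq0.
  rewrite qfactS qevM mulf_neq0 ?IHk ?(ltnW hk) //.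
  apply/eqP => h0; have := qev_qint k.+1; rewrite h0 mulr0.
  move/esym/eqP; rewrite subr_eq0 -(prim_order_dvd pw) => /dvdn_leq; lia.
have z : qev (qfact e) = 0.
  rewrite -(prednK e_gt0) qfactS qevM prednK //.
  have -> : qev (qint e) = 0; last by rewrite mulr0.
  have w1 : w - 1 != 0.
    by rewrite subr_eq0 -[w]expr1 -(prim_order_dvd pw); apply/negP => /dvdn_leq; lia.
  by apply: (mulfI w1); rewrite qev_qint (prim_expr_order pw) subrr mulr0.
move: (congr1 qev h); rewrite !qevM z => /eqP.
rewrite !mulf_eq0 (negbTE (nz _ re)) (negbTE (nz (e - r)%N _)) ?orbF; last by lia.
by move/eqP.
Qed.

(** All the intermediate coefficients of index [e] vanish at [w], so adding [e]
    to the upper index acts as a single step of the ordinary Pascal rule. *)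
Lemma qbinom_at_addn m r : qbinom_at (m + e) r =
  qbinom_at m r + (if (e <= r)%N then qbinom_at m (r - e) else 0).
Proof.
elim: m r => [|m IHm] r.
  rewrite add0n; case: (ltngtP r e) => [lt|gt|->].
  - case: r lt => [|r] lt; first by rewrite !qbinom_at0 addr0.
    by rewrite qbinom_at_order ?(@qbinom_at_small 0) ?addr0.
  - by rewrite !qbinom_at_small ?addr0 //; lia.
  - rewrite subnn qbinom_at0 [qbinom_at 0 e]qbinom_at_small // add0r /qbinom_at.
    by rewrite -[qbinom e e]/(gauss 0 e) gaussC gauss0 qev1.
case: r => [|r]; first by rewrite !qbinom_at0 leqNgt e_gt0 addr0.
rewrite addSn !qbinom_atS !IHm; case: (ltngtP e r.+1) => [lt|lt|eq].
- rewrite -ltnS lt subSn // qbinom_atS.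
  have -> : w ^+ (r - e).+1 = w ^+ r.+1.
    by rewrite -[in RHS](@subnK e r.+1) ?(ltnW lt) // exprD (prim_expr_order pw) mulr1 subSn.
  ring.
- rewrite ifF; last by lia.
  by ring.
- rewrite ifF; last by lia.
  by rewrite -eq subnn !qbinom_at0 (prim_expr_order pw); ring.
Qed.

Lemma qbinom_lucas D r : qbinom_at (D * e) r = if (e %| r)%N then 'C(D, r %/ e)%:R else 0.
Proof.
elim: D r => [|D IH] r.
  case: r => [|r]; first by rewrite qbinom_at0 dvdn0 div0n.
  rewrite qbinom_at_small //; case: ifP => // h.
  by rewrite bin0n eqn0Ngt divn_gt0 // dvdn_leq.
rewrite mulSn addnC qbinom_at_addn !IH; case: (leqP e r) => er; last first.
  rewrite addr0; case: ifP => // h; case: r er h => [|r] er h; last first.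
    by have := dvdn_leq (ltn0Sn _) h; rewrite leqNgt er.
  by rewrite div0n !bin0.
rewrite dvdn_subl //; case: ifP => // h; last by rewrite addr0.
have /dvdnP[[|k] ek] := h; first by lia.
rewrite ek mulnK // mulSn addnC addnK mulnK //.
by rewrite binS natrD.
Qed.

End Lucas.

(** * Matching parentheses along a height function *)

Definition match_at (H : nat -> int) (i j : nat) : bool :=
  [&& (i < j)%N, H j.+1 == H i
    & [forall k : 'I_j.+1, (i < k)%N ==> (H i < H k)]].

Lemma match_atP H i j : reflect
  [/\ (i < j)%N, H j.+1 = H i & forall k, (i < k <= j)%N -> H i < H k]
  (match_at H i j).
Proof.
apply: (iffP and3P) => [[ij /eqP e /forallP h]|[ij e h]]; split=> //.
- move=> k /andP[ik kj].
  exact: (implyP (h (Ordinal (kj : (k < j.+1)%N))) ik).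
- by apply/eqP.
- by apply/forallP => k; apply/implyP => ik; apply: h; rewrite ik -ltnS ltn_ord.
Qed.

(** When [H (t + h) = H t + 1], one position per period escapes: it is an
    opening parenthesis that is never closed. *)
Definition escape_at (H : nat -> int) (h i : nat) : bool :=
  [forall k : 'I_h, H i < H (i + k.+1)%N].

Lemma escape_atP H h i : reflect
  (forall k, (i < k <= i + h)%N -> H i < H k) (escape_at H h i).
Proof.
apply: (iffP forallP) => [hk k /andP[ik kh]|hk k].
  have lt : (k - i.+1 < h)%N by lia.
  have := hk (Ordinal lt); rewrite /=.
  by have -> : (i + (k - i.+1).+1)%N = k by lia.
by apply: hk; have := ltn_ord k; lia.
Qed.

(** Escaping positions are joined to their translate by [h]; modulo [2 h] this
    is a diameter. *)
Definition joins (H : nat -> int) (h i j : nat) : bool :=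
  match_at H i j || escape_at H h i && (j == i + h)%N.

Section Steps.
Variables (H : nat -> int) (h : nat).
Hypothesis Hstep : forall t, -1 <= H t.+1 - H t <= 1.

Lemma joins_up i j : (0 < h)%N -> joins H h i j -> H i.+1 = H i + 1.
Proof.
have st := Hstep i; move=> h0.
case/orP => [/match_atP[ij e lt]|/andP[/escape_atP esc _]].
  by have := lt i.+1; lia.
by have := esc i.+1; lia.
Qed.

Lemma match_down i j : match_at H i j -> H j.+1 = H j - 1.
Proof.
have st := Hstep j; move=> /match_atP[ij e lt].
by have := lt j; lia.
Qed.

(** The first return to the height of [i], if any, closes the arc of [i]. *)
Lemma up_joins i : H i.+1 = H i + 1 -> exists j, joins H h i j.
Proof.
move=> up; case esc: (escape_at H h i).
  by exists (i + h)%N; rewrite /joins esc eqxx orbT.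
have ex : exists k, (i < k)%N && (H k <= H i).
  move/negbT: esc; rewrite negb_forall => /existsP[k]; rewrite -leNgt => le.
  by exists (i + k.+1)%N; rewrite le; lia.
have [k /andP[ik le] min] := ex_minnP ex.
have lt m : (i < m < k)%N -> H i < H m.
  by move=> hm; have := min m; lia.
have k2 : (i.+1 < k)%N.
  by rewrite ltn_neqAle ik andbT; apply/eqP => e; subst k; lia.
exists k.-1; apply/orP; left; apply/match_atP.
have st := Hstep k.-1; rewrite prednK in st *; last by lia.
have := lt k.-1.
split; [lia | lia |].
by move=> m hm; apply: lt; lia.
Qed.

End Steps.

Section Arcs.
Variables (H : nat -> int) (h n : nat) (s : int).
(* [s] is the number of diameters that the arcs have modulo [n]. *)
Hypothesis Hper : forall t, H (t + h)%N = H t + s.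
Hypothesis h_gt0 : (0 < h)%N.
Hypothesis h_n : (h %| n)%N.
Hypothesis n_gt0 : (0 < n)%N.
Hypothesis s01 : s = 0 \/ s = 1 /\ n = (2 * h)%N.

Let le_hn : (h <= n)%N. Proof. exact: dvdn_leq. Qed.

Let s_ge0 : 0 <= s. Proof. by case: s01 => [->|[->]]. Qed.
Let s_le1 : s <= 1. Proof. by case: s01 => [->|[->]]. Qed.

Lemma height_shiftM q t : H (t + q * h)%N = H t + s * q%:Z.
Proof.
elim: q => [|q IH]; first by rewrite mul0n addn0 mulr0 addr0.
by rewrite mulSn (addnC h) addnA Hper IH -addn1 PoszD; ring.
Qed.

Lemma match_lt i j : match_at H i j -> (j < i + h)%N.
Proof.
move=> /match_atP[ij e lt]; rewrite ltnNge; apply/negP => le.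
have := Hper (j.+1 - h); rewrite subnK; last by lia.
have : H i < H (j.+1 - h)%N by apply: lt; lia.
lia.
Qed.

Lemma joins_span i j : joins H h i j -> (i < j <= i + h)%N.
Proof.
case/orP => [m|/andP[_ /eqP->]]; last by lia.
have := match_lt m; case/match_atP: m; lia.
Qed.

Lemma joins_shift q i j : joins H h (i + q * h) (j + q * h) = joins H h i j.
Proof.
congr orb.
  apply/match_atP/match_atP => -[ij e lt]; split; try lia.
  - by move: e; rewrite -addSn !height_shiftM; lia.
  - move=> k hk; have := lt (k + q * h)%N; rewrite !height_shiftM; lia.
  - by rewrite -addSn !height_shiftM; lia.
  - move=> k hk; rewrite -(@subnK (q * h) k); last by lia.
    by have := lt (k - q * h)%N; rewrite !height_shiftM; lia.
congr andb; last by lia.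
apply: eq_forallb => k.
by rewrite addnAC !height_shiftM ltrD2r.
Qed.

Lemma escapeP i : escape_at H h i -> forall k, (i < k)%N -> H i < H k.
Proof.
move=> /escape_atP esc k ik.
have -> : k = (i.+1 + (k - i.+1) %% h + (k - i.+1) %/ h * h)%N.
  by have := divn_eq (k - i.+1) h; lia.
have := @esc (i.+1 + (k - i.+1) %% h)%N; have := ltn_pmod (k - i.+1) h_gt0.
rewrite height_shiftM; have : 0 <= s * ((k - i.+1) %/ h)%:Z by rewrite mulr_ge0.
lia.
Qed.

Lemma escape_s i : escape_at H h i -> s = 1 /\ n = (2 * h)%N.
Proof.
move=> /escapeP/(_ (i + h)%N); rewrite Hper; case: s01 => // ->; lia.
Qed.

Lemma escape_shift i : escape_at H h i -> escape_at H h (i + h).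
Proof.
move=> /escapeP esc; apply/escape_atP => k hk.
have := esc (k - h)%N; have := Hper (k - h); rewrite [H (i + h)%N]Hper subnK; lia.
Qed.

(** Arcs are noncrossing as a match stays above its starting height, whereas
    nothing returns to the height of an escaping position.  The last case is
    that of a diameter read from its other end. *)
Lemma joins_nested i j k l : joins H h i j -> joins H h k l -> (i <= k <= j)%N ->
  [\/ (i < k)%N /\ (l < j)%N, i = k /\ j = l | k = j /\ (l = i + n)%N].
Proof.
move=> a1 a2 hk.
have := joins_span a1; have := joins_span a2.
case/orP: a1 => [/match_atP[ij e lt]|/andP[esc /eqP ej]];
  case/orP: a2 => [/match_atP[kl e' lt']|/andP[esc' /eqP el]] b2 b1.
- case: (ltngtP i k) => [ik|ik|ik]; last 2 first.
  + by lia.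
  + subst k; case: (ltngtP j l) => jl; last by constructor 2.
      by have := lt' j.+1; lia.
    by have := lt l.+1; lia.
  + constructor 1; split=> //; rewrite ltnNge; apply/negP => jl.
    have := lt k; case: (ltngtP j l) => jl'; [| lia |].
      by have := lt' j.+1; lia.
    by have := lt l; subst l; lia.
- have kj : H k < H j.+1 by apply: (escapeP esc'); lia.
  case: (ltngtP i k) => ik; [|lia|by subst k; lia].
  by have := lt k; lia.
- have ek := escapeP esc.
  have ek' := escapeP (escape_shift esc).
  constructor 1; split.
    rewrite ltn_neqAle (andP hk).1 andbT; apply/eqP => ik.
    by have := ek l.+1; subst k; lia.
  rewrite ltnNge; apply/negP => jl; subst j.
  have := ek' l.+1; case: (ltngtP k (i + h)) => kj; [|lia|subst k; lia].
  by have := lt' (i + h)%N; lia.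
- have ek := escapeP esc; have ek' := escapeP esc'.
  have [s1 n2] := escape_s esc.
  case: (ltngtP i k) => ik; [|lia|]; last by constructor 2; lia.
  case: (ltngtP k j) => kj; [|lia|]; last by constructor 3; lia.
  by have := ek k ik; have := ek' j kj; rewrite ej Hper s1; lia.
Qed.

Hypothesis Hstep : forall t, -1 <= H t.+1 - H t <= 1.

(** The last earlier visit to the height reached after [j] opens the arc of
    [j]; it lies within one period since [0 <= s]. *)
Lemma down_match j : (h <= j)%N -> H j.+1 = H j - 1 -> exists i, match_at H i j.
Proof.
move=> hj dn.
have ex : exists i, (i <= j)%N && (H i <= H j.+1).
  exists (j.+1 - h)%N; have := Hper (j.+1 - h); rewrite subnK; lia.
have [|i /andP[ij le] max] := ex_maxnP ex (m := j).
  by move=> i /andP[].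
have gt m : (i < m <= j)%N -> H j.+1 < H m by move=> hm; have := max m; lia.
have ij' : (i < j)%N.
  by rewrite ltn_neqAle ij andbT; apply/eqP => e; subst i; lia.
exists i; apply/match_atP; have := gt i.+1; have := Hstep i; split=> //; first lia.
by move=> k hk; have := gt k; lia.
Qed.

End Arcs.

(** * Matchings of the circle read on the natural numbers *)

Lemma modn_eq_add (n i j : nat) : i = j %[mod n] -> (i <= j)%N ->
  exists q, j = (i + q * n)%N.
Proof.
move=> e le; exists ((j - i) %/ n)%N; rewrite divnK ?subnKC //.
by rewrite -eqn_mod_dvd // e.
Qed.

Lemma modn_inj_lt (n x i j : nat) : (x <= i < x + n)%N -> (x <= j < x + n)%N ->
  i = j %[mod n] -> i = j.
Proof.
wlog le : i j / (i <= j)%N.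
  move=> W hi hj e; case: (leqP i j) => [le|/ltnW le]; first exact: W.
  exact/esym/W.
move=> hi hj e; have [[|q] ej] := modn_eq_add e le; first by rewrite ej addn0.
move: hj; rewrite ej.
by rewrite mulSn; move: (q * n)%N => r; lia.
Qed.

Section Configs.
Variable n' : nat.
Let n := n'.+1.
Implicit Types (E : {set {set 'I_n'.+1}}) (c : ncc n'.+1).

Lemma inZp_eq (i j : nat) : (inZp i == inZp j :> 'I_n'.+1) = (i == j %[mod n]).
Proof. by []. Qed.

Lemma inZpDn (t : nat) : inZp (t + n) = inZp t :> 'I_n'.+1.
Proof. by apply: val_inj; rewrite /= modnDr. Qed.

Lemma inZp_lt (t : nat) (lt : (t < n)%N) : inZp t = Ordinal lt.
Proof. by apply: val_inj; rewrite /= modn_small. Qed.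

Lemma ordS_inZp (t : nat) : ordS (inZp t : 'I_n'.+1) = inZp t.+1.
Proof. by apply: val_inj; rewrite /= -addn1 modnDml addn1. Qed.

(** Positions range over all natural numbers, to be read modulo [n]: cyclic
    intervals are then plain intervals, and rotations are translations. *)
Definition adj E (i j : nat) : bool := [set inZp i; inZp j] \in E.

Definition cov E (t : nat) : bool := inZp t \in cover E.

Lemma adjC E i j : adj E i j = adj E j i.
Proof. by rewrite /adj setUC. Qed.

Lemma adjDr E i j : adj E i (j + n) = adj E i j.
Proof. by rewrite /adj inZpDn. Qed.

Lemma adjDl E i j : adj E (i + n) j = adj E i j.
Proof. by rewrite /adj inZpDn. Qed.

Lemma covDn E t : cov E (t + n) = cov E t.
Proof. by rewrite /cov inZpDn. Qed.

Lemma adj_cov E i j : adj E i j -> cov E i.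
Proof. by move=> a; apply/bigcupP; exists [set inZp i; inZp j]; rewrite ?set21. Qed.

Section Ncc.
Variable c : ncc n'.+1.
Let E := (ncc_val c).1.

Lemma ncc_card e : e \in E -> #|e| = 2%N.
Proof. by have /and4P[/forall_inP h _ _ _] := valP c => /h/eqP. Qed.

Lemma ncc_same e e' v : e \in E -> e' \in E -> v \in e -> v \in e' -> e = e'.
Proof.
have /and4P[_ /trivIsetP h _ _] := valP c => eE eE' ve ve'.
apply/eqP; apply/negPn/negP => ne.
by have /disjointFr := h _ _ eE eE' ne => /(_ _ ve); rewrite ve'.
Qed.

Lemma adj_neq i j : adj E i j -> i <> j %[mod n].
Proof.
move=> /ncc_card; rewrite cards2; case: eqP => // ne _ e; apply: ne.
by apply: val_inj.
Qed.

Lemma adj_fun i j k : adj E i j -> adj E i k -> j = k %[mod n].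
Proof.
move=> a1 a2; have e := ncc_same a1 a2 (set21 _ _) (set21 _ _).
have /set2P[e'|/(congr1 val)//] : inZp j \in [set inZp i; inZp k : 'I_n'.+1].
  by rewrite -e set22.
by case: (adj_neq a1); apply/esym/(congr1 val e').
Qed.

Lemma no_cross (a b d e : nat) : (a < b < d)%N -> (d < e < n)%N ->
  adj E a d -> adj E b e -> False.
Proof.
move=> abd de a1 a2.
have /and4P[_ _ /forall_inP/(_ _ a1)/forall_inP/(_ _ a2)/negP h _] := valP c.
apply: h.
apply/exists_inP; exists (inZp a); rewrite ?set21 //.
apply/exists_inP; exists (inZp b); rewrite ?set21 //.
apply/exists_inP; exists (inZp d); rewrite ?set22 //.
apply/exists_inP; exists (inZp e); rewrite ?set22 //=.
by rewrite !modn_small; lia.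
Qed.

(** The condition on four points in increasing order is invariant under cyclic
    shifts: any four points of a window of length [n] may be tested. *)
Lemma adj_nc i j k l : (i < j < k)%N -> (k < l < i + n)%N ->
  adj E i k -> adj E j l -> False.
Proof.
have [q] := ubnP i; elim: q => // q IH in i j k l *; move=> iq ijk kl a1 a2.
case: (leqP n i) => ni.
  have sub x y : (n <= x)%N -> (n <= y)%N -> adj E (x - n) (y - n) = adj E x y.
    by move=> hx hy; rewrite -adjDr -adjDl !subnK.
  apply: (IH (i - n) (j - n) (k - n) (l - n))%N; rewrite ?sub //; lia.
case: (leqP n l) => nl; last by apply: (@no_cross i j k l) => //; lia.
case: (leqP n k) => nk; last first.
  apply: (@no_cross (l - n) i j k) => //; try lia.
  by rewrite adjC -adjDr subnK.
case: (leqP n j) => nj; last first.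
  apply: (@no_cross (k - n) (l - n) i j); try lia.
    by rewrite adjC -adjDr subnK.
  by rewrite adjC -adjDr subnK.
apply: (@no_cross (j - n) (k - n) (l - n) i); try lia.
  by rewrite -adjDl -adjDr !subnK.
by rewrite adjC -adjDr subnK.
Qed.

Lemma covP t : reflect (exists2 j, (t < j < t + n)%N & adj E t j) (cov E t).
Proof.
apply: (iffP idP) => [/bigcupP[e eE te]|[j _ /adj_cov]//].
have /cards2P[x [y [xy ee]]] : #|e| == 2%N by rewrite ncc_card.
have [z ez tz] : exists2 z, e = [set inZp t; z] & inZp t != z.
  move: te; rewrite ee => /set2P[->|->]; first by exists y.
  by exists x; [rewrite setUC|rewrite eq_sym].
have nz : (z : nat) <> t %[mod n].
  by move=> h; case/eqP: tz; apply: val_inj; rewrite /= -h modn_small.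
have md : (t + (z + n - t %% n) %% n)%N = z %[mod n].
  rewrite modnDmr -modnDml addnC subnK ?modnDr //.
  by have := ltn_pmod t (ltn0Sn n'); lia.
exists (t + (z + n - t %% n) %% n)%N.
  have := ltn_pmod (z + n - t %% n) (ltn0Sn n'); rewrite -/n.
  case: ((_ + n - _) %% n)%N md => [|d] md; last by lia.
  by rewrite addn0 in md; case: nz.
rewrite /adj; have -> : inZp (t + (z + n - t %% n) %% n) = z; last by rewrite -ez.
by apply: val_inj; rewrite /= md modn_small.
Qed.

Lemma adj_inside i j k : (i < k < j)%N -> (j < i + n)%N -> adj E i j -> cov E k ->
  exists2 l, (i < l < j)%N & adj E k l.
Proof.
move=> ikj jn a1 /covP[l kl a2].
case: (ltngtP l j) => lj; first by exists l => //; lia.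
  case: (ltngtP l (i + n)) => li.
  - by case: (@adj_nc i k j l) => //; lia.
  - exists (l - n)%N; first by lia.
    by rewrite -adjDr subnK //; lia.
  - subst l; rewrite adjDr adjC in a2.
    by have := adj_fun a1 a2 => /(@modn_inj_lt _ i); lia.
subst l; rewrite adjC in a1; rewrite adjC in a2.
by have := adj_fun a1 a2 => /(@modn_inj_lt _ i); lia.
Qed.

End Ncc.

Lemma adj_ext c c' :
  (forall i j, adj (ncc_val c).1 i j = adj (ncc_val c').1 i j) ->
  (ncc_val c).1 = (ncc_val c').1.
Proof.
move=> h; apply/setP => e; wlog suff : c c' h / e \in (ncc_val c).1 -> e \in (ncc_val c').1.
  by move=> W; apply/idP/idP; apply: W.
move=> eE; have /cards2P[x [y [_ ee]]] : #|e| == 2%N by rewrite (ncc_card eE).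
by move: eE (h x y); rewrite /adj !valZpK -ee => ->.
Qed.

(** Arcs are invariant under translation by [n] and have length below [n], so a
    representative can be found with [i < n] and [j < 2 n]. *)
Definition edges_of (A : nat -> nat -> bool) : {set {set 'I_n'.+1}} :=
  [set e | [exists i : 'I_n, exists j : 'I_(2 * n),
     A i j && (e == [set inZp i; inZp j])]].

Section EdgesOf.
Variable A : nat -> nat -> bool.
Hypothesis A_lt : forall i j, A i j -> (i < j < i + n)%N.
Hypothesis A_shift : forall i j, A (i + n) (j + n) = A i j.
Hypothesis A_nested : forall i j k l, A i j -> A k l -> (i <= k <= j)%N ->
  [\/ (i < k)%N /\ (l < j)%N, i = k /\ j = l | k = j /\ (l = i + n)%N].

Lemma A_shiftM q i j : A (i + q * n) (j + q * n) = A i j.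
Proof.
elim: q => [|q IH]; first by rewrite !addn0.
by rewrite mulSn (addnC n) !addnA A_shift.
Qed.

Lemma edges_ofP e : reflect
  (exists i j, A i j /\ e = [set inZp i; inZp j]) (e \in edges_of A).
Proof.
rewrite inE; apply: (iffP existsP) => [[i /existsP[j /andP[a /eqP e']]]|].
  by exists i, j.
move=> [i [j [a ->]]]; have := A_lt a.
have ltq := ltn_pmod i (ltn0Sn n').
have ei : i = (i %% n + i %/ n * n)%N by rewrite addnC -divn_eq.
move=> ij; have ej : j = (j - i %/ n * n + i %/ n * n)%N.
  by rewrite subnK //; move: ei ij; rewrite -/n; lia.
have ltj : (j - i %/ n * n < 2 * n)%N by move: ltq ei ij; rewrite -/n; lia.
exists (Ordinal ltq); apply/existsP; exists (Ordinal ltj) => /=.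
rewrite -(A_shiftM (i %/ n)) -ei -ej a /=.
apply/eqP; congr [set _; _]; apply: val_inj => /=; first by rewrite modn_mod.
by rewrite [in LHS]ej addnC modnMDl.
Qed.

Lemma A_adj i j : A i j -> adj (edges_of A) i j.
Proof. by move=> a; apply/edges_ofP; exists i, j. Qed.

Lemma A_move i j t : A i j -> i = t %[mod n] -> A t (t + (j - i)).
Proof.
move=> a e; have ij := A_lt a; case: (leqP i t) => [le|/ltnW le].
  have [q ->] := modn_eq_add e le.
  by rewrite -addnA (addnC (q * n)%N) addnA subnKC ?A_shiftM //; lia.
have [q ei] := modn_eq_add (esym e) le.
rewrite -(A_shiftM q) -ei addnAC -ei subnKC //; lia.
Qed.

(** Far enough from [0], every endpoint of an edge can be taken to be the given
    representative [t], with the arc starting or ending there. *)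
Lemma edge_at e t : (n <= t)%N -> e \in edges_of A -> inZp t \in e ->
  exists j, (A t j \/ A j t) /\ e = [set inZp t; inZp j].
Proof.
move=> nt /edges_ofP[i [j [a ->]]] /set2P[] /eqP; rewrite inZp_eq => /eqP e'.
  exists (t + (j - i))%N; split; first by left; apply: A_move.
  congr [set _; _]; apply: val_inj => //=.
  by rewrite -modnDml e' modnDml subnKC //; have := A_lt a; lia.
have ij := A_lt a.
have e2 : (t - (j - i))%N = i %[mod n].
  apply/eqP; rewrite -(eqn_modDr (j - i)) subnK ?subnKC; try lia.
exists (t - (j - i))%N; split.
  right; have := A_move a (esym e2); rewrite subnK //; lia.
rewrite setUC; congr [set _; _]; apply: val_inj => //=.
Qed.

Lemma edges_same e e' v : e \in edges_of A -> e' \in edges_of A ->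
  v \in e -> v \in e' -> e = e'.
Proof.
have -> : v = inZp (v + n) by rewrite inZpDn valZpK.
set t := (v + n)%N; have nt : (n <= t)%N by rewrite leq_addl.
move=> /(edge_at nt) h /(edge_at nt) h' /h[j [a ->]] /h'[j' [a' ->]] {h h'}.
congr [set _; _]; apply: val_inj => /=; rewrite -/n.
case: a => a; case: a' => a'; have lta := A_lt a; have lta' := A_lt a'.
- by case: (A_nested a a') => //; try lia; case=> _ ->.
- case: (A_nested a' a); try lia.
  by case=> _ ->; rewrite modnDr.
- case: (A_nested a a'); try lia.
  by case=> _ ->; rewrite modnDr.
- case: (leqP j j') => le.
    by case: (A_nested a a'); try lia; case=> ->.
  by case: (A_nested a' a); try lia; case=> ->.
Qed.

Lemma edges_lift x y : (x < y < x + n)%N ->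
  adj (edges_of A) x y -> A x y \/ A y (x + n).
Proof.
rewrite /adj -(inZpDn x) => xy a.
have [|j [h es]] := edge_at _ a (set21 _ _); first by rewrite leq_addl.
have jy : y = j %[mod n].
  have : inZp y \in [set inZp (x + n); inZp y : 'I_n'.+1] by rewrite set22.
  rewrite es => /set2P[] /eqP; rewrite inZp_eq => /eqP // e.
  have := @modn_inj_lt n x x y; rewrite e modnDr; lia.
case: h => h; have := A_lt h => lt.
  left; rewrite -A_shift.
  have -> // : (y + n)%N = j.
  by apply: (@modn_inj_lt n (x + n)); [lia|lia|rewrite modnDr].
have <- // : j = y; last by right.
by apply: (@modn_inj_lt n x.+1); [lia|lia|].
Qed.

Lemma edges_card e : e \in edges_of A -> #|e| = 2%N.
Proof.
move=> /edges_ofP[i [j [/A_lt ij ->]]]; rewrite cards2 inZp_eq; case: eqP => // h.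
by have := @modn_inj_lt n i i j; lia.
Qed.

(** If two distinct edges crossed or met, some translates of their arcs would
    overlap without being nested. *)
Lemma edges_nc (L : {set 'I_n'.+1}) :
  [disjoint L & cover (edges_of A)] -> is_ncc (edges_of A, L : {set 'I_n'.+1}).
Proof.
move=> dL; apply/and4P; split=> //=.
- by apply/forall_inP => e /edges_card/eqP.
- apply/trivIsetP => e e' eE eE'; apply: contraR => /pred0Pn[v /andP[/= ve ve']].
  by apply/eqP; apply: (edges_same eE eE' ve ve').
apply/forall_inP => e eE; apply/forall_inP => e' eE'.
apply/negP => /exists_inP[a ae] /exists_inP[b be] /exists_inP[x xe].
move=> /exists_inP[y ye] /and3P[ab bx xy].
have pair (f : {set 'I_n'.+1}) (u v : 'I_n'.+1) :
    f \in edges_of A -> u \in f -> v \in f -> (u < v)%N -> A u v \/ A v (u + n).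
  move=> fE uf vf uv; apply: edges_lift; first by rewrite uv (leq_trans (ltn_ord v)) ?leq_addl.
  rewrite /adj !valZpK; have <- // : f = [set u; v].
  apply/esym/eqP; rewrite eqEcard (edges_card fE) cards2 subUset !sub1set uf vf /=.
  by case: eqP => // uv'; move: uv; rewrite uv' ltnn.
have ax := ltn_trans ab bx; have b_y := ltn_trans bx xy.
have yn := ltn_ord y; move: ab bx xy ax b_y yn.
have {pair} := (pair _ _ _ eE' be ye, pair _ _ _ eE ae xe) => -[].
move: (nat_of_ord a) (nat_of_ord b) (nat_of_ord x) (nat_of_ord y).
move=> {ae be xe ye}{}a {}b {}x {}y h2 h1 ab bx xy /h1 {}h1 /h2 {}h2 yn.
case: h1 => h1; case: h2 => h2.
- by case: (A_nested h1 h2); lia.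
- by rewrite -A_shift in h1; case: (A_nested h2 h1); lia.
- by case: (A_nested h2 h1); lia.
- by case: (A_nested h1 h2); lia.
Qed.

End EdgesOf.

End Configs.

(** * Configurations as periodic words *)
Section Encode.
Variable n' : nat.
Let n := n'.+1.
Implicit Types (E : {set {set 'I_n'.+1}}) (c : ncc n'.+1).

(** The twist flips the mark of a vertex leaving the position [0], hence the
    parity of the ceiling of [t / n]: with it the twist acts on marks as a
    translation, see [loop_twist]. *)
Definition loop c (t : nat) : bool :=
  (inZp t \in (ncc_val c).2) (+) odd ((t + n') %/ n).

Lemma loopDn c t : loop c (t + n) = ~~ loop c t.
Proof. by rewrite /loop inZpDn addnAC divnDr // divnn oddD addbA addbT. Qed.

Lemma loop_cov c t : inZp t \in (ncc_val c).2 -> ~~ cov (ncc_val c).1 t.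
Proof.
move=> tL; have /and4P[_ _ _ d] := valP c.
by rewrite /cov (disjointFr d tL).
Qed.

Lemma ncc_ext c c' :
  (forall i j, adj (ncc_val c).1 i j = adj (ncc_val c').1 i j) ->
  (forall t, ~~ cov (ncc_val c).1 t -> loop c t = loop c' t) -> c = c'.
Proof.
move=> /adj_ext eE hL; apply: ncc_eqP => [e|v]; first by rewrite eE.
rewrite -[v]valZpK; case: (boolP (cov (ncc_val c).1 v)) => hc; last first.
  by have := hL _ hc; rewrite /loop => /addIb.
apply/idP/idP => /loop_cov; last by rewrite -eE hc.
by rewrite hc.
Qed.

Lemma adj_twist c i j : adj (ncc_val (twist c)).1 i.+1 j.+1 = adj (ncc_val c).1 i j.
Proof.
rewrite /adj /= -!ordS_inZp.
have -> : [set ordS (inZp i); ordS (inZp j)] =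
    @ordS n'.+1 @: [set inZp i; inZp j] by rewrite imsetU1 imset_set1.
by rewrite mem_imset //; apply: imset_inj; apply: ordS_inj.
Qed.

Lemma cov_twist c t : cov (ncc_val (twist c)).1 t.+1 = cov (ncc_val c).1 t.
Proof. by rewrite /cov /= cover_rot -ordS_inZp mem_imset //; apply: ordS_inj. Qed.

Lemma loop_twist c t : ~~ cov (ncc_val c).1 t -> loop (twist c) t.+1 = loop c t.
Proof.
move=> hc; rewrite /loop /= -ordS_inZp mem_imset; last exact: ordS_inj.
rewrite inE hc andbT.
have -> : (t.+1 + n' = (t + n').+1)%N by [].
have -> : ((t + n').+1 %/ n = (n %| t) + (t + n') %/ n)%N.
  by rewrite divnS // -addnS dvdn_addl.
rewrite oddD addbA; congr (_ (+) _).
by rewrite /= -/(dvdn n t); case: (dvdn _ _); case: (_ \in _).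
Qed.

Lemma iter_twist_adj k c i j :
  adj (ncc_val (iter k (@twist _) c)).1 (i + k) (j + k) = adj (ncc_val c).1 i j.
Proof. by elim: k => [|k IH]; rewrite ?addn0 // !addnS iterS adj_twist. Qed.

Lemma iter_twist_loop k c t : ~~ cov (ncc_val c).1 t ->
  ~~ cov (ncc_val (iter k (@twist _) c)).1 (t + k) /\
  loop (iter k (@twist _) c) (t + k) = loop c t.
Proof.
move=> hc; elim: k => [|k [IH1 IH2]]; first by rewrite addn0.
by rewrite addnS iterS cov_twist loop_twist.
Qed.

Lemma periodicM T (f : nat -> T) d : (forall t, f (t + d)%N = f t) ->
  forall q t, f (t + q * d)%N = f t.
Proof.
by move=> h; elim=> [|q IH] t; rewrite ?addn0 // mulSn (addnC d) addnA h IH.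
Qed.

Lemma loopD2n c t : loop c (t + 2 * n) = loop c t.
Proof. by rewrite mul2n -addnn addnA !loopDn negbK. Qed.

Lemma adjD E i j : adj E (i + n) (j + n) = adj E i j.
Proof. by rewrite adjDl adjDr. Qed.

Lemma adjDM E q i j : adj E (i + q * n) (j + q * n) = adj E i j.
Proof. by elim: q => [|q IH]; rewrite ?addn0 // mulSn (addnC n) !addnA adjD IH. Qed.

Lemma covE c t : cov (ncc_val c).1 t = [exists j : 'I_n, adj (ncc_val c).1 t j].
Proof.
apply/covP/existsP => [[j _ a]|[j a]].
  by exists (inZp j); move: a; rewrite /adj valZpK.
by have /covP := adj_cov a.
Qed.

Lemma cov_per c D : (forall i j, adj (ncc_val c).1 (i + D) (j + D) = adj (ncc_val c).1 i j) ->
  forall t, cov (ncc_val c).1 (t + D) = cov (ncc_val c).1 t.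
Proof.
move=> h t; apply/idP/idP.
  move=> /covP[j tj a]; apply: (@adj_cov _ _ _ (j - D)).
  by rewrite -h subnK //; lia.
by move=> /covP[j tj a]; apply: (@adj_cov _ _ _ (j + D)); rewrite h.
Qed.

(** Both conditions say that the twist to the power [D], which translates edges
    and marks by [D], gives back the same data. *)
Lemma fix_twistP D c : iter D (@twist _) c = c <->
  (forall i j, adj (ncc_val c).1 (i + D) (j + D) = adj (ncc_val c).1 i j) /\
  (forall t, ~~ cov (ncc_val c).1 t -> loop c (t + D) = loop c t).
Proof.
split=> [e|[h1 h2]].
  split=> [i j|t hc]; first by rewrite -{1}e iter_twist_adj.
  by rewrite -{1}e; have [] := iter_twist_loop D hc.
have hM q i j : adj (ncc_val c).1 (i + q * D) (j + q * D) = adj (ncc_val c).1 i j.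
  by elim: q => [|q IH]; rewrite ?addn0 // mulSn (addnC D) !addnA h1 IH.
have hcM q t : cov (ncc_val c).1 (t + q * D) = cov (ncc_val c).1 t.
  by rewrite (periodicM (cov_per h1)).
have hL q t : ~~ cov (ncc_val c).1 t -> loop c (t + q * D) = loop c t.
  elim: q => [|q IH] hc; first by rewrite addn0.
  by rewrite mulSn (addnC D) addnA h2 ?IH // hcM.
(* The translation by [D * (2 * n)] is trivial and ends with one by [D], which
   is what the iterated twist performs. *)
have sh t : (t + D * (2 * n) = t + (2 * n).-1 * D + D)%N.
  by rewrite -addnA -mulSnr prednK // mulnC.
apply/esym/ncc_ext => [i j|t hc].
  rewrite -[in RHS](adjDM _ (D * 2)) -!mulnA !sh iter_twist_adj.
  by rewrite hM.
rewrite -[in RHS](periodicM (loopD2n _) D) sh.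
have hc' : ~~ cov (ncc_val c).1 (t + (2 * n).-1 * D) by rewrite hcM.
by have [_ ->] := iter_twist_loop D hc'; rewrite hL.
Qed.

(** [1], [-1] or [0] according to whether [t] opens, closes or is uncovered. *)
Definition weight (b : nat -> bool) (t : nat) : int :=
  (b t)%:Z + (b (t + n)%N)%:Z - 1.

Definition height (b : nat -> bool) (t : nat) : int := \sum_(k < t) weight b k.

Lemma heightS b t : height b t.+1 = height b t + weight b t.
Proof. by rewrite /height big_ord_recr. Qed.

Lemma weight_bound b t : -1 <= weight b t <= 1.
Proof. by rewrite /weight; case: (b t); case: (b _). Qed.

Lemma height_step b t : -1 <= height b t.+1 - height b t <= 1.
Proof. by have := weight_bound b t; rewrite heightS; lia. Qed.

(** [r t] bounds how far from [t] the other endpoint may be for [t] to count as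
    the opening end of its edge. *)
Definition opens (r : nat -> nat) E (t : nat) : bool :=
  [exists k : 'I_n, (k < r t)%N && adj E t (t + k)].

Lemma opensP r E t : reflect
  (exists2 j, [/\ (t <= j)%N, (j < t + n)%N & (j < t + r t)%N] & adj E t j)
  (opens r E t).
Proof.
apply: (iffP existsP) => [[k /andP[kr a]]|[j [tj jn jr] a]].
  by exists (t + k)%N => //; have := ltn_ord k; rewrite -/n; split; lia.
have lt : (j - t < n)%N by lia.
by exists (Ordinal lt); rewrite /= subnKC // a andbT; lia.
Qed.

Definition encode (r : nat -> nat) c (t : nat) : bool :=
  if cov (ncc_val c).1 t then opens r (ncc_val c).1 t else loop c t.

Section Weight.
Variables (r : nat -> nat) (c : ncc n'.+1).
Hypothesis rn : forall t, r (t + n)%N = r t.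
Let E := (ncc_val c).1.

Lemma opens_per E' t : opens r E' (t + n) = opens r E' t.
Proof. by apply: eq_existsb => k; rewrite rn addnAC adjD. Qed.

Lemma weight_encode t : weight (encode r c) t =
  if cov E t then if opens r E t then 1 else -1 else 0.
Proof.
rewrite /weight /encode covDn opens_per loopDn -/E.
by case: (cov E t); case: (opens r E t); case: (loop c t).
Qed.

Lemma encode2n t : encode r c (t + 2 * n) = encode r c t.
Proof.
rewrite /encode mul2n -addnn addnA !covDn !opens_per !loopDn negbK //.
Qed.

End Weight.

(** A block of consecutive positions closed under partners, with arcs oriented
    from left to right, is a balanced parenthesis word: each closing position
    has its opening one in the block, so heights stay above the initial one, and
    symmetrically for the final one.  The interior of an arc is again such a
    block, which allows an induction on the length. *)
Lemma closed_block c (H w : nat -> int) (E := (ncc_val c).1) a z :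
  (forall t, H t.+1 = H t + w t) ->
  (z <= a + n)%N -> (a <= z)%N ->
  (forall k, (a <= k < z)%N -> cov E k -> exists2 l, (a <= l < z)%N & adj E k l) ->
  (forall k, (a <= k < z)%N -> ~~ cov E k -> w k = 0) ->
  (forall k l, (a <= k < z)%N -> (k < l < z)%N -> adj E k l -> w k = 1 /\ w l = -1) ->
  [/\ H z = H a, forall k, (a <= k <= z)%N -> H a <= H k
    & forall k l, (a <= k < z)%N -> (k < l < z)%N -> adj E k l -> match_at H k l].
Proof.
move=> HS; have [q] := ubnP (z - a); elim: q a z => // q IH a z lq za az cl w0 w1.
have M k l : (a <= k < z)%N -> (k < l < z)%N -> adj E k l -> match_at H k l.
  move=> hk hl a1; have [wk wl] := w1 _ _ hk hl a1.
  have [|||p hp|p hp|p p' hp hp'|e mn _] := IH k.+1 l; try lia.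
  - move=> hc; have [||m hm am] := adj_inside (k := p) _ _ a1 hc; try lia.
    by exists m => //; lia.
  - by apply: w0; lia.
  - by apply: w1; lia.
  apply/match_atP; split; first by lia.
    by rewrite HS e HS wk wl; lia.
  by move=> m hm; have := mn m; rewrite HS wk; lia.
have up k : (a <= k <= z)%N -> H a <= H k.
  have [p] := ubnP k; elim: p k => // p IHp k hp hk.
  case: (ltngtP a k) => ak; [|lia|by rewrite ak].
  have kz : (a <= k.-1 < z)%N by lia.
  have := HS k.-1; rewrite prednK; last by lia.
  have := IHp k.-1; case: (boolP (cov E k.-1)) => [hc|/(w0 _ kz)]; last by lia.
  have [l hl al] := cl _ kz hc.
  case: (ltngtP l k.-1) => lk.
  - rewrite adjC in al; have /match_atP[_] := M l k.-1 hl ltac:(lia) al.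
    rewrite prednK; last by lia.
    by move=> -> _ _ _; apply: IHp; lia.
  - by have [] := w1 k.-1 l kz ltac:(lia) al; lia.
  - by subst l; case: (adj_neq al).
have dn k : (a <= k <= z)%N -> H z <= H k.
  have [p] := ubnP (z - k); elim: p k => // p IHp k hp hk.
  case: (ltngtP k z) => ak; [|lia|by rewrite ak].
  have kz : (a <= k < z)%N by lia.
  have := HS k.
  have := IHp k.+1; case: (boolP (cov E k)) => [hc|/(w0 _ kz)]; last by lia.
  have [l hl al] := cl _ kz hc.
  case: (ltngtP l k) => lk.
  - rewrite adjC in al; have [] := w1 l k hl ltac:(lia) al; lia.
  - have /match_atP[_ <- _ _ _] := M k l kz ltac:(lia) al; apply: IHp; lia.
  - by subst l; case: (adj_neq al).
split=> //.
by have := up z; have := dn a; lia.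
Qed.

(** A strictly larger matching covers strictly more vertices. *)
Lemma eq_of_sub_edges c c' :
  (forall i j, (i < j < i + n)%N -> adj (ncc_val c).1 i j -> adj (ncc_val c').1 i j) ->
  (forall t, cov (ncc_val c').1 t -> cov (ncc_val c).1 t) ->
  forall i j, adj (ncc_val c).1 i j = adj (ncc_val c').1 i j.
Proof.
move=> h1 h2 i j.
have sub : forall e, e \in (ncc_val c).1 -> e \in (ncc_val c').1.
  move=> e eE; have /card_gt0P[v ve] : (0 < #|e|)%N by rewrite (ncc_card eE).
  have cv : cov (ncc_val c).1 v by apply/bigcupP; exists e; rewrite ?valZpK.
  have [k hk a] := covP _ _ cv.
  rewrite (ncc_same eE a ve); first exact: h1.
  by rewrite valZpK set21.
apply/idP/idP; first exact: sub.
move=> a; have /covP[k hk a'] := h2 _ (adj_cov a).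
rewrite /adj (ncc_same a (sub _ a') (set21 _ _)) //.
by rewrite set21.
Qed.

Lemma weightDn b : (forall t, b (t + 2 * n)%N = b t) ->
  forall t, weight b (t + n) = weight b t.
Proof.
by move=> b2n t; rewrite /weight -addnA addnn -mul2n b2n [X in X - 1]addrC.
Qed.

Section Decode.
Variables (b : nat -> bool) (h : nat) (s : int).
Hypothesis b2n : forall t, b (t + 2 * n)%N = b t.
Hypothesis Hper : forall t, height b (t + h)%N = height b t + s.
Hypothesis h_gt0 : (0 < h)%N.
Hypothesis h_n : (h %| n)%N.
Hypothesis s01 : s = 0 \/ s = 1 /\ n = (2 * h)%N.

Let H := height b.
Let A := joins H h.
Let n_gt0 : (0 < n)%N := ltn0Sn n'.
Let Hst := height_step b.

Lemma dec_lt i j : A i j -> (i < j < i + n)%N.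
Proof.
case/orP => [m|/andP[esc /eqP ->]].
  have := match_lt Hper h_gt0 h_n n_gt0 s01 m; have := dvdn_leq n_gt0 h_n.
  by case/match_atP: m; rewrite -/n; lia.
by have [_ ->] := escape_s Hper h_gt0 h_n n_gt0 s01 esc; lia.
Qed.

Lemma dec_shift i j : A (i + n) (j + n) = A i j.
Proof. by rewrite -(divnK h_n); exact: (joins_shift Hper h_gt0 h_n n_gt0 s01). Qed.

Lemma dec_nested i j k l : A i j -> A k l -> (i <= k <= j)%N ->
  [\/ (i < k)%N /\ (l < j)%N, i = k /\ j = l | k = j /\ (l = i + n)%N].
Proof. exact: (joins_nested Hper h_gt0 h_n n_gt0 s01). Qed.

Definition dec_edges : {set {set 'I_n'.+1}} := edges_of n' A.

(** For [v < n] the ceiling of [v / n] in [loop] is [0 < v]. *)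
Definition dec_loops : {set 'I_n'.+1} :=
  [set v | (v \notin cover dec_edges) && (b v (+) (0 < v)%N)].

Lemma dec_ncc : is_ncc (dec_edges, dec_loops).
Proof.
apply: (edges_nc dec_lt dec_shift dec_nested).
rewrite disjoint_subset; apply/subsetP => v; rewrite !inE.
by case/andP.
Qed.

Definition decode : ncc n'.+1 := NCC dec_ncc.

Lemma dec_cov t : cov dec_edges t = (weight b t != 0).
Proof.
rewrite -covDn -(weightDn b2n); set t' := (t + n)%N.
have nt : (n <= t')%N by rewrite leq_addl.
have := heightS b t'; have := weight_bound b t' => wb hS.
apply/idP/idP.
  move=> /bigcupP[e eE te]; have [j [a _]] := edge_at dec_lt dec_shift nt eE te.
  case: a => a.
    by have := joins_up Hst h_gt0 a; rewrite /H; lia.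
  case/orP: a => [m|/andP[esc /eqP et]].
    by have := match_down Hst m; rewrite /H; lia.
  have esc' := escape_shift Hper h_gt0 h_n n_gt0 s01 esc.
  have a' : A t' (t' + h) by apply/orP; right; rewrite et esc' eqxx.
  by have := joins_up Hst h_gt0 a'; rewrite /H; lia.
move=> w0; have [w1|w1] : weight b t' = 1 \/ weight b t' = -1 by lia.
  have [|j a] := @up_joins H h Hst t'; first by rewrite /H; lia.
  exact: adj_cov (A_adj dec_lt dec_shift a).
have [||i m] := @down_match H h n s Hper h_gt0 h_n n_gt0 s01 Hst t'.
- by apply: leq_trans nt; apply: dvdn_leq.
- by rewrite /H; lia.
have a : A i t' by rewrite /A /joins m.
by have := A_adj dec_lt dec_shift a; rewrite adjC; apply: adj_cov.
Qed.

Lemma dec_adj_up i j : adj dec_edges i j -> adj dec_edges (i + h) (j + h).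
Proof.
have shift x y : [set inZp (x + h); inZp (y + h)] =
    iter h (@ordS n'.+1) @: [set inZp x; inZp y].
  have it t : inZp (t + h) = iter h (@ordS n'.+1) (inZp t).
    by elim: (h) => [|k IH]; rewrite ?addn0 // addnS -ordS_inZp IH.
  by rewrite imsetU1 imset_set1 !it.
rewrite /adj shift => /(edges_ofP dec_lt dec_shift)[x [y [a ->]]].
rewrite -shift; apply: (A_adj dec_lt dec_shift).
by have := joins_shift Hper h_gt0 h_n n_gt0 s01 1 x y; rewrite mul1n /A => ->.
Qed.

Lemma dec_adj_per i j : adj dec_edges (i + h) (j + h) = adj dec_edges i j.
Proof.
apply/idP/idP; last exact: dec_adj_up.
have upM q x y : adj dec_edges x y -> adj dec_edges (x + q * h) (y + q * h).
  elim: q => [|q IH] a; first by rewrite !addn0.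
  by rewrite mulSn (addnC h) !addnA; apply/dec_adj_up/IH.
move/(upM (n %/ h).-1); rewrite -!addnA -mulSn prednK ?divnK //.
  by rewrite adjD.
by rewrite divn_gt0 // dvdn_leq.
Qed.

Lemma dec_loopE v : (v < n)%N -> weight b v = 0 -> loop decode v = b v.
Proof.
move=> vn w0; have := dec_cov v; rewrite w0 eqxx => cv.
rewrite /loop /= inE inZp_lt.
have -> : Ordinal vn \notin cover dec_edges by rewrite -inZp_lt; apply/negbT.
have -> : odd ((v + n') %/ n) = (0 < v)%N.
  case: v {cv w0} vn => [|v] vn; first by rewrite add0n divn_small.
  by rewrite addSnnS -/n divnDr // divnn divn_small //; lia.
by rewrite /= -addbA addbb addbF.
Qed.

(** Only the orientation of the edges depends on [r]: the vertices of nonzero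
    weight are the covered ones in any case. *)
Lemma decodeK r : (forall t, weight b t = 1 -> opens r dec_edges t) ->
  (forall t, weight b t = -1 -> ~~ opens r dec_edges t) ->
  encode r decode =1 b.
Proof.
move=> h1 h2 t; rewrite /encode /= dec_cov.
have := weight_bound b t => wb.
case: eqP => /= [w0|w0].
  rewrite [t](divn_eq t n) addnC in w0 *.
  elim: (t %/ n)%N w0 => [|q IH].
    by rewrite mul0n addn0; apply: dec_loopE; rewrite ltn_pmod.
  rewrite mulSn (addnC n) addnA (weightDn b2n) loopDn => w0; rewrite IH //.
  by move: w0; rewrite /weight; case: (b _); case: (b _).
have [w1|w1] : weight b t = 1 \/ weight b t = -1 by lia.
  by rewrite h1 //; move: w1; rewrite /weight; case: (b _); case: (b _).
by rewrite (negbTE (h2 _ w1)); move: w1; rewrite /weight; case: (b _); case: (b _).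
Qed.

Lemma decode_fix r D : encode r decode =1 b -> (h %| D)%N ->
  (forall t, b (t + D) = b t)%N -> iter D (@twist _) decode = decode.
Proof.
move=> bE hD bD; have aD i j : adj dec_edges (i + D) (j + D) = adj dec_edges i j.
  case/dvdnP: hD => q ->.
  by elim: q => [|q IH]; rewrite ?addn0 // mulSn (addnC h) !addnA dec_adj_per IH.
apply/fix_twistP; split=> // t hc.
have := bE (t + D)%N; have := bE t; rewrite bD /encode (cov_per (c := decode)) //.
by rewrite (negbTE hc) => -> ->.
Qed.

(** Edges of [c] need only be found among the decoded ones, as both matchings
    cover the same vertices. *)
Lemma decode_encode r c : encode r decode =1 b -> b =1 encode r c ->
  (forall t, r (t + n) = r t)%N ->
  (forall i j, (i < j < i + n)%N -> adj (ncc_val c).1 i j -> adj dec_edges i j) ->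
  decode = c.
Proof.
move=> bE bc rn sub.
have cE t : cov dec_edges t = cov (ncc_val c).1 t.
  rewrite dec_cov /weight !bc -/(weight (encode r c) t) weight_encode //.
  by case: (cov _ t) => //; case: (opens _ _ t).
have sub' t : cov (ncc_val decode).1 t -> cov (ncc_val c).1 t by rewrite /= cE.
apply: ncc_ext => [i j|t hc].
  exact/esym/eq_of_sub_edges.
have := bE t; rewrite bc /encode -cE (negbTE hc) //.
Qed.

End Decode.

End Encode.

(** * Trivial rotation: edges open at their smaller endpoint *)
Section Line.
Variable n' : nat.
Let n := n'.+1.
Let n_gt0 : (0 < n)%N := ltn0Sn n'.

Lemma height_per b h : (forall t, weight n' b (t + h) = weight n' b t) ->
  forall t, height n' b (t + h) = height n' b t + height n' b h.
Proof.
move=> wh; elim=> [|t IH]; first by rewrite add0n /height big_ord0 add0r.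
by rewrite addSn !heightS IH wh; ring.
Qed.

(** Distance to the next multiple of [n]. *)
Definition to_end (t : nat) : nat := (n - t %% n)%N.

Lemma to_endDn t : to_end (t + n) = to_end t.
Proof. by rewrite /to_end modnDr. Qed.

Lemma to_endE t : (t + to_end t = t %/ n * n + n)%N.
Proof.
rewrite /to_end {1}(divn_eq t n) -addnA subnKC //.
exact/ltnW/ltn_pmod.
Qed.

Section DecodeLine.
Variable b : nat -> bool.
Hypothesis b2n : forall t, b (t + 2 * n)%N = b t.
Hypothesis Hn : height n' b n = 0.
Hypothesis Hge : forall k, (k <= n)%N -> 0 <= height n' b k.

Lemma line_period t : height n' b (t + n) = height n' b t + 0.
Proof. by rewrite height_per ?Hn // => k; apply: weightDn. Qed.

Lemma line_periodM q t : height n' b (t + q * n) = height n' b t.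
Proof. by apply: periodicM => k; rewrite line_period addr0. Qed.

Lemma height_ge0 t : 0 <= height n' b t.
Proof. by rewrite (divn_eq t n) addnC line_periodM Hge // ltnW // ltn_pmod. Qed.

Lemma height_end t : height n' b (t + to_end t) = 0.
Proof.
rewrite to_endE addnC line_periodM //.
Qed.

Let s00 : 0 = 0 :> int \/ 0 = 1 :> int /\ n = (2 * n)%N. Proof. by left. Qed.

Definition decode_line : ncc n'.+1 := decode line_period n_gt0 (dvdnn n) s00.

(** The height is [0] at multiples of [n] and never negative: no arc goes past
    such a point. *)
Lemma joins_line i j : joins (height n' b) n i j -> (j < i + to_end i)%N.
Proof.
case/orP => [/match_atP[ij e lt]|/andP[esc _]].
  rewrite ltnNge; apply/negP => le.
  have := lt (i + to_end i)%N; rewrite height_end.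
  have := height_ge0 i; have : (0 < to_end i)%N by rewrite subn_gt0 ltn_pmod.
  lia.
by have [] := escape_s line_period n_gt0 (dvdnn n) n_gt0 s00 esc.
Qed.

Lemma decode_lineK : encode to_end decode_line =1 b.
Proof.
have lt := dec_lt line_period n_gt0 (dvdnn n) s00.
have sh := dec_shift line_period n_gt0 (dvdnn n) s00.
apply: decodeK => // t w1.
  have [|j a] := @up_joins (height n' b) n (height_step n' b) t.
    by rewrite heightS w1.
  apply/opensP; exists j; last exact: (A_adj lt sh a).
  by have := lt _ _ a; have := joins_line a; rewrite -/n; split; lia.
have [||i m] := down_match line_period n_gt0 (dvdnn n) n_gt0 s00 (height_step n' b) (j := t + n).
- by rewrite leq_addl.
- by rewrite heightS weightDn // w1.
have a : joins (height n' b) n i (t + n) by rewrite /joins m.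
apply/negP => /opensP[k [tk kn kt] ak].
have ai := A_adj lt sh a; rewrite adjC adjDl in ai.
have := adj_fun (c := decode_line) ak ai; rewrite -/n => e.
have := joins_line a; have := lt _ _ a; rewrite -/n => /andP[it ti] ie.
have : (t %/ n * n + n <= i)%N.
  rewrite leqNgt; apply/negP => lti.
  have := to_endE i; move: ie.
  have : (i %/ n <= t %/ n)%N by rewrite -ltnS ltn_divLR // mulSn addnC.
  have := leq_trunc_div t n.
  move=> h1 h2 h3 h4; have : (i %/ n * n <= t %/ n * n)%N by rewrite leq_mul2r h2 orbT.
  lia.
have := @modn_inj_lt n (t %/ n * n + n) (k + n) i.
rewrite modnDr e => inj h; have := inj; rewrite to_endE in kt.
have := leq_trunc_div t n; lia.
Qed.

End DecodeLine.

Section EncodeLine.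
Variables (c : ncc n'.+1) (b : nat -> bool).
Hypothesis bE : b =1 encode to_end c.
Let E := (ncc_val c).1.

Lemma line_weight t : weight n' b t =
  if cov E t then if opens to_end E t then 1 else -1 else 0.
Proof.
by rewrite -weight_encode; [rewrite /weight !bE|apply: to_endDn].
Qed.

Lemma line_block : [/\ height n' b n = 0, forall k, (k <= n)%N -> 0 <= height n' b k
  & forall k l, (k < l < n)%N -> adj E k l -> match_at (height n' b) k l].
Proof.
have te k : (k < n)%N -> (k + to_end k = n)%N.
  by move=> kn; rewrite to_endE divn_small.
have [|||k hk|k hk|k l hk hl a|e h1 h2] := @closed_block n' c (height n' b) (weight n' b) 0 n.
- exact: heightS.
- by rewrite add0n.
- by [].
- rewrite covE => /existsP[j a]; exists (j : nat) => //.
  exact: ltn_ord.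
- by rewrite line_weight => /negbTE ->.
- rewrite !line_weight (adj_cov a); have a' := a; rewrite adjC in a'.
  rewrite (adj_cov a') ifT; last first.
    by apply/opensP; exists l => //; have := te k; rewrite -/n; split; lia.
  split=> //; rewrite ifN //; apply/negP => /opensP[m [lm _ mr] al].
  rewrite te in mr; last by lia.
  have mk : m = k; last by lia.
  by apply: (@modn_inj_lt n 0); [lia|lia|apply: adj_fun al a'].
split.
- by rewrite e /height big_ord0.
- by move=> k hk; have := h1 k; rewrite {1}/height big_ord0; apply; lia.
- by move=> k l hkl; apply: h2; lia.
Qed.

Lemma decode_line_encode (b2n : forall t, b (t + 2 * n)%N = b t)
   (Hn : height n' b n = 0) (Hge : forall k, (k <= n)%N -> 0 <= height n' b k) :
  decode_line b2n Hn = c.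
Proof.
apply: (@decode_encode _ _ _ _ b2n _ _ _ _ to_end) => //; first exact: decode_lineK.
  exact: to_endDn.
have [_ _ hm] := line_block.
have lt := dec_lt (line_period b2n Hn) n_gt0 (dvdnn n) (or_introl erefl).
have sh := dec_shift (line_period b2n Hn) n_gt0 (dvdnn n) (or_introl erefl).
have main i j : (i < j < n)%N -> adj E i j -> adj (dec_edges n' b n) i j.
  by move=> ij a; apply: (A_adj lt sh); rewrite /joins hm.
move=> i j _ a.
have inE0 k : inZp k = inZp (k %% n) :> 'I_n'.+1 by apply: val_inj; rewrite /= modn_mod.
move: (a); rewrite /adj (inE0 i) (inE0 j) -!/(adj _ _ _) => a'.
have := ltn_pmod i n_gt0; have := ltn_pmod j n_gt0.
have := adj_neq a; rewrite -/n.
case: (ltngtP (i %% n) (j %% n)) => // h _ h1 h2; first by apply: main => //; lia.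
by rewrite adjC; apply: main; [lia|rewrite adjC].
Qed.

End EncodeLine.

End Line.

(** * Nontrivial rotation: edges open towards their short side *)

(** The last minimum over a period: subtracting [t] from [h] times the height
    breaks ties in favour of the later position. *)
Lemma last_min (H : nat -> int) h s : (0 < h)%N ->
  (forall t, H (t + h)%N = H t + s) -> 0 < s ->
  exists i, forall k, (i < k <= i + h)%N -> H i < H k.
Proof.
case: h => // h _ Hper s0.
have [i _ min] := @arg_minP _ int 'I_h.+1 ord0 xpredT
  (fun t => H t * h.+1%:Z - (t : nat)%:Z) isT.
exists i => k hk; have ih := ltn_ord i.
case: (leqP k h) => kh.
  have := min (Ordinal (kh : (k < h.+1)%N)) isT => /=; nia.
have lt : (k - h.+1 < h.+1)%N by lia.
have := min (Ordinal lt) isT => /=; have := Hper (k - h.+1)%N; rewrite subnK //.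
nia.
Qed.

(** The first minimum over a period, taken beyond [q h] to leave room on its
    left, where the position matching it will be sought. *)
Lemma first_min (H : nat -> int) h s q : (0 < h)%N ->
  (forall t, H (t + h)%N = H t + s) -> s < 0 ->
  exists2 i, (q * h < i)%N & forall k, (i <= k + h)%N -> (k < i)%N -> H i < H k.
Proof.
case: h => // h _ Hper s0.
have [i _ min] := @arg_minP _ int 'I_h.+1 ord0 xpredT
  (fun t => H t * h.+1%:Z + (t : nat)%:Z) isT.
have HM m t : H (t + m * h.+1)%N = H t + s * m%:Z.
  elim: m => [|m IH]; first by rewrite mul0n addn0 mulr0 addr0.
  by rewrite mulSn (addnC h.+1) addnA Hper IH -addn1 PoszD; ring.
exists (i + q.+1 * h.+1)%N; first by lia.
move=> k hk ki; have ih := ltn_ord i; rewrite HM.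
case: (leqP (q.+1 * h.+1) k) => kq.
  have lt : (k - q.+1 * h.+1 < h.+1)%N by lia.
  have := min (Ordinal lt) isT => /=; have := HM q.+1 (k - q.+1 * h.+1)%N.
  rewrite subnK //; nia.
have lt : (k - q * h.+1 < h.+1)%N by lia.
have := min (Ordinal lt) isT => /=; have := HM q (k - q * h.+1)%N.
rewrite subnK; last by lia.
have -> : q.+1%:Z = q%:Z + 1 by lia.
nia.
Qed.

Section Round.
Variables (n' h : nat).
Let n := n'.+1.
Let n_gt0 : (0 < n)%N := ltn0Sn n'.
Hypothesis h_gt0 : (0 < h)%N.
Hypothesis h_n : (h %| n)%N.
Hypothesis h2n : (2 * h <= n)%N.

(** Length [h] is included, so that both ends of a diameter open. *)
Definition reach (t : nat) : nat := h.+1.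

Section DecodeRound.
Variables (b : nat -> bool) (s : int).
Hypothesis b2n : forall t, b (t + 2 * n)%N = b t.
Hypothesis Hper : forall t, height n' b (t + h) = height n' b t + s.
Hypothesis s01 : s = 0 \/ s = 1 /\ n = (2 * h)%N.

Lemma decode_roundK : encode reach (decode Hper h_gt0 h_n s01) =1 b.
Proof.
have lt := dec_lt Hper h_gt0 h_n s01.
have sh := dec_shift Hper h_gt0 h_n s01.
apply: decodeK => // t w1.
  have [|j a] := @up_joins (height n' b) h (height_step n' b) t.
    by rewrite heightS w1.
  apply/opensP; exists j; last exact: (A_adj lt sh a).
  have := lt _ _ a; have := joins_span Hper h_gt0 h_n n_gt0 s01 a.
  by rewrite -/n /reach; split; lia.
have [||i m] := down_match Hper h_gt0 h_n n_gt0 s01 (height_step n' b) (j := t + n).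
- by apply: leq_trans (leq_addl _ _); apply: dvdn_leq.
- by rewrite heightS weightDn // w1.
have mlt := match_lt Hper h_gt0 h_n n_gt0 s01 m.
have a : joins (height n' b) h i (t + n) by rewrite /joins m.
apply/negP => /opensP[k [tk kn kt] ak].
have ai := A_adj lt sh a; rewrite adjC adjDl in ai.
have := adj_fun (c := decode Hper h_gt0 h_n s01) ak ai; rewrite -/n => e.
have := lt _ _ a; rewrite -/n /reach in kt * => ie.
by have := @modn_inj_lt n t k i; lia.
Qed.

End DecodeRound.

Section EncodeRound.
Variables (c : ncc n'.+1) (b : nat -> bool).
Let E := (ncc_val c).1.
Let H := height n' b.
Hypothesis adj_per : forall i j, adj E (i + h) (j + h) = adj E i j.
Hypothesis bE : b =1 encode reach c.

Lemma round_weight t : weight n' b t =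
  if cov E t then if opens reach E t then 1 else -1 else 0.
Proof. by rewrite -weight_encode // /weight !bE. Qed.

Lemma round_opens_per t : opens reach E (t + h) = opens reach E t.
Proof. by apply: eq_existsb => k; rewrite addnAC adj_per. Qed.

Lemma round_height t : H (t + h)%N = H t + H h.
Proof.
apply: height_per => k.
by rewrite !round_weight round_opens_per (cov_per adj_per).
Qed.

(** A chord longer than [h] on both sides crosses its translate by [h]; if it
    has length [h] it meets it, hence equals it and is a diameter. *)
Lemma chord_short i j : (i < j < i + n)%N -> adj E i j ->
  [\/ (j < i + h)%N, (i + n < j + h)%N | j = (i + h)%N /\ n = (2 * h)%N].
Proof.
move=> ij a; have a' := a; rewrite -adj_per in a'.
case: (ltngtP j (i + h)) => jh; first by constructor 1.
  case: (ltngtP (j + h) (i + n)) => jn; last 2 first.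
  - by constructor 2.
  - rewrite jn adjDr adjC in a'.
    have e : j = (i + h)%N; last by lia.
    by apply: (@modn_inj_lt n i); [lia|lia|apply: adj_fun a a'].
  by case: (@adj_nc _ c i (i + h) j (j + h)) => //; lia.
subst j; constructor 3; split=> //.
rewrite adjC in a.
have e : (i + h + h = i + n)%N; last by lia.
apply: (@modn_inj_lt n i.+1); [lia|lia|].
by rewrite modnDr; apply/esym/(adj_fun a a').
Qed.

Lemma round_opens i j : (i < j <= i + h)%N -> adj E i j -> weight n' b i = 1.
Proof.
move=> ij a; rewrite round_weight (adj_cov a) ifT //.
by apply/opensP; exists j => //; rewrite /reach -/n; split; lia.
Qed.

Lemma round_closes i j : (i < j < i + h)%N -> adj E i j -> weight n' b j = -1.
Proof.
move=> ij; rewrite adjC => a; rewrite round_weight (adj_cov a) ifN //.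
apply/negP => /opensP[k [jk kn kr] a'].
have := adj_fun a a' => /(@modn_inj_lt n i); rewrite /reach in kr; lia.
Qed.

(** The interior of a chord of length at most [h] is a closed block, so its two
    ends have the same height.  For a diameter this leaves the rise at [i] as
    the whole variation over a period, and makes [i] escape. *)
Lemma round_joins i j : (i < j <= i + h)%N -> adj E i j ->
  joins H h i j /\ (j = i + h -> H h = 1 /\ n = 2 * h)%N.
Proof.
move=> ij a; have wi := round_opens ij a.
have [|||k hk|k hk|k l hk hl ak|e h1 h2] :=
    @closed_block n' c (height n' b) (weight n' b) i.+1 j.
- exact: heightS.
- by rewrite -/n; lia.
- by lia.
- move=> hc; have [||l hl al] := adj_inside _ _ a hc; rewrite -?/n; try lia.
  by exists l => //; lia.
- by rewrite round_weight => /negbTE ->.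
- by rewrite (round_opens _ ak) ?(round_closes _ ak); lia.
have Hi := heightS n' b i; rewrite wi in Hi.
case: (ltngtP j (i + h)) => jh; [|lia|].
  split; last by lia.
  have wj := round_closes (i := i) (j := j) ltac:(lia) a.
  apply/orP; left; apply/match_atP; split; first by lia.
    by rewrite /H heightS wj e Hi; lia.
  by move=> k hk; have := h1 k; rewrite /H; lia.
have s1 : H h = 1 by have := round_height i; rewrite /H -jh e Hi; lia.
split; last first.
  move=> _; split=> //.
  by case: (@chord_short i j _ a) => [|||[]]; rewrite -/n; lia.
apply/orP; right; rewrite jh eqxx andbT; apply/escape_atP => k hk.
by have := h1 k; rewrite /H; lia.
Qed.

(** If the height grew, its last minimum would be an opening position that is
    never closed: without diameters there is none.  If it decreased, its first
    minimum would end a closing step that was never opened. *)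
Lemma round_s : H h = 0 \/ H h = 1 /\ n = (2 * h)%N.
Proof.
case diam : [exists i : 'I_n, adj E i (i + h)].
  case/existsP: diam => i a; right.
  by have [|_ dj] := round_joins _ a; [lia | exact: dj].
left.
have nodiam i : ~~ adj E i (i + h).
  apply/negP => a; move/negbT/negP: diam; apply; apply/existsP; exists (inZp i).
  rewrite /adj valZpK -[inZp (_ + h)](_ : inZp (i + h) = _) //.
  by apply: val_inj; rewrite /= modnDml.
case: (ltrgtP 0 (H h)) => // s0.
  have [i min] := last_min h_gt0 round_height s0.
  have [k [ik kn kr] a] : exists2 k,
      [/\ (i <= k)%N, (k < i + n)%N & (k < i + reach i)%N] & adj E i k.
    apply/opensP; have := min i.+1; rewrite /H heightS round_weight.
    by case: (cov E i); case: (opens _ _ _) => //; lia.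
  have ik' : (i < k)%N.
    by rewrite ltn_neqAle ik andbT; apply/eqP => e; subst k; case: (adj_neq a).
  rewrite /reach in kr.
  have [|jo dj] := round_joins (i := i) (j := k) _ a; first by lia.
  case/orP: jo => [/match_atP[_ e _]|/andP[_ /eqP e]].
    have := min k.+1; rewrite e; case: (ltngtP k (i + h)) => kh; try lia.
    by subst k; move/negP: (nodiam i).
  by subst k; move/negP: (nodiam i).
have [p pn min] := first_min (n %/ h) h_gt0 round_height s0.
rewrite divnK // in pn.
have wp : weight n' b p.-1 = -1.
  have := min p.-1; have := heightS n' b p.-1; rewrite prednK; last by lia.
  have := weight_bound n' b p.-1; rewrite /H; lia.
have [k hk a] : exists2 k, (p.-1 < k < p.-1 + n)%N & adj E p.-1 k.
  by apply/covP; move: wp; rewrite round_weight; case: (cov E p.-1).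
have kh : (p.-1 + h < k)%N.
  rewrite ltnNge; apply/negP => kh.
  by have := @round_opens p.-1 k; rewrite wp => /(_ _ a); lia.
have sub : (k - n < p.-1)%N by lia.
have a' : adj E (k - n) p.-1.
  by rewrite adjC -adjDr subnK //; lia.
have [|||[e1 e2]] := chord_short _ a; try lia.
move=> kn; have [|jo dj] := round_joins (i := k - n) (j := p.-1) _ a'; first by lia.
case/orP: jo => [/match_atP[_ e _]|/andP[_ /eqP e]]; last by lia.
by have := min (k - n)%N; rewrite -e prednK; lia.
Qed.

Lemma decode_round_encode (b2n : forall t, b (t + 2 * n)%N = b t) s
    (Hper : forall t, height n' b (t + h) = height n' b t + s)
    (s01 : s = 0 \/ s = 1 /\ n = (2 * h)%N) :
  decode Hper h_gt0 h_n s01 = c.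
Proof.
apply: (@decode_encode _ _ _ _ b2n _ _ _ _ reach) => //; first exact: decode_roundK.
have lt := dec_lt Hper h_gt0 h_n s01.
have sh := dec_shift Hper h_gt0 h_n s01.
have main i j : (i < j <= i + h)%N -> adj E i j -> adj (dec_edges n' b h) i j.
  by move=> ij a; have [jo _] := round_joins ij a; apply: (A_adj lt sh).
move=> i j ij a; case: (chord_short ij a) => [h1|h1|[h1 _]].
- by apply: main => //; lia.
- by rewrite adjC -adjDr; apply: main; [lia | rewrite adjDr adjC].
- by apply: main => //; lia.
Qed.

End EncodeRound.

End Round.

(** * Sets of words *)

Definition fixed (n D : nat) : {set ncc n} := [set c | iter D (@twist n) c == c].

Lemma in_fixed n D c : (c \in fixed n D) = (iter D (@twist n) c == c).
Proof. by rewrite inE. Qed.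

(** Decoding is the bijection: from good words onto the configurations fixed by
    the twist to the power [D]. *)
Lemma card_fixed_words n' D (X : finType) (beta : X -> nat -> bool)
    (good : pred X) (r : nat -> nat)
    (dec : (nat -> bool) -> config n'.+1) :
  (forall x, good x -> exists c : ncc n'.+1,
     [/\ ncc_val c = dec (beta x), iter D (@twist _) c = c & encode r c =1 beta x]) ->
  (forall c : ncc n'.+1, iter D (@twist _) c = c ->
     exists2 x, good x & dec (beta x) = ncc_val c) ->
  (forall x y, beta x =1 beta y -> x = y) ->
  #|fixed n'.+1 D| = #|[set x | good x]|.
Proof.
move=> h1 h2 inj.
rewrite -(card_imset (mem (fixed _ D)) (@val_inj _ _ (ncc n'.+1))).
have <- : [set dec (beta x) | x in [set x | good x]] =
          [set ncc_val c | c in fixed n'.+1 D].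
  apply/setP => e; apply/imsetP/imsetP => [[x]|[c]]; rewrite inE.
    by move=> /h1[c [<- fc _]] ->; exists c; rewrite // inE fc.
  by move=> /eqP/h2[x gx ex] ->; exists x; rewrite ?inE.
rewrite card_in_imset // => x y; rewrite !inE => gx gy e; apply: inj => t.
have [[c [ec _ bc]] [c' [ec' _ bc']]] := (h1 x gx, h1 y gy).
by rewrite -bc -bc'; congr (encode r _ t); apply: val_inj; rewrite /= ec ec' e.
Qed.

(** In the linear case the letters at [t] and [t + n] are read together; the
    pair of distinct letters stands for an uncovered vertex. *)
Definition step (p : bool * bool) : int := p.1%:Z + p.2%:Z - 1.

Fixpoint ballot (a : int) (s : seq (bool * bool)) : bool :=
  if s is p :: s' then (0 <= a) && ballot (a + step p) s' else a == 0.

Lemma ballotP a s : reflect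
  ((forall k, (k <= size s)%N -> 0 <= a + \sum_(i < k) step (nth (false, false) s i)) /\
   a + \sum_(i < size s) step (nth (false, false) s i) = 0)
  (ballot a s).
Proof.
elim: s a => [|p s IH] a /=.
  apply: (iffP eqP) => [->|[_]]; last by rewrite big_ord0 addr0.
  by split=> [[|k]|] //; rewrite big_ord0.
apply: (iffP andP) => [[a0 /IH[h1 h2]]|[h1 h2]].
  split=> [[|k]|]; first by rewrite big_ord0 addr0.
    by rewrite ltnS big_ord_recl addrA => /h1.
  by rewrite big_ord_recl addrA.
split; first by have := h1 0%N isT; rewrite big_ord0 addr0.
apply/IH; split=> [k hk|]; last by move: h2; rewrite big_ord_recl addrA.
by have := h1 k.+1 hk; rewrite big_ord_recl addrA.
Qed.

(** A configuration fixed by the twist to the power [n] covers all vertices. *)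
Definition allowed (loopless : bool) (p : bool * bool) : bool := loopless ==> (p.1 == p.2).

Section LineWords.
Variables (n' : nat) (loopless : bool).
Let n := n'.+1.
Let D := (if loopless then n else 2 * n)%N.
Implicit Type u : n.-tuple (bool * bool).

Definition line_word u (t : nat) : bool :=
  let p := nth (false, false) u (t %% n) in if odd (t %/ n) then p.2 else p.1.

Lemma line_word_lo u t : (t < n)%N -> line_word u t = (nth (false, false) u t).1.
Proof. by move=> tn; rewrite /line_word modn_small // divn_small. Qed.

Lemma line_word_hi u t : (t < n)%N ->
  line_word u (t + n) = (nth (false, false) u t).2.
Proof.
move=> tn; rewrite /line_word modnDr modn_small //.
by rewrite divnDr // divnn divn_small.
Qed.

Lemma line_word2n u t : line_word u (t + 2 * n) = line_word u t.
Proof.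
rewrite /line_word addnC modnMDl divnMDl // oddD.
by [].
Qed.

Lemma height_line_word u k : (k <= n)%N ->
  height n' (line_word u) k = \sum_(i < k) step (nth (false, false) u i).
Proof.
move=> kn; apply: eq_bigr => i _.
have lt : (i < n)%N by apply: leq_trans kn.
by rewrite /weight line_word_lo // line_word_hi.
Qed.

Definition line_good u := all (allowed loopless) u && ballot 0 u.

Lemma line_word_D u : all (allowed loopless) u ->
  forall t, line_word u (t + D) = line_word u t.
Proof.
rewrite /D; case: loopless => [al t|_ t]; last exact: line_word2n.
have := all_nthP (false, false) al (t %% n)%N; rewrite size_tuple ltn_pmod // => /(_ isT).
rewrite /allowed /= /line_word modnDr divnDr // divnn addn1 /=.
by move/eqP => ->; rewrite !if_same.
Qed.

Lemma card_fixed_line : #|fixed n D| = #|[set u | line_good u]|.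
Proof.
apply: (@card_fixed_words _ _ _ line_word _ (to_end n')
  (fun b => (dec_edges n' b n, dec_loops n' b n))) => [u|c fc|u v e].
- case/andP => al /ballotP[]; rewrite size_tuple add0r => ge e0.
  have Hn : height n' (line_word u) n = 0 by rewrite height_line_word.
  have Hge k : (k <= n)%N -> 0 <= height n' (line_word u) k.
    by move=> kn; rewrite height_line_word //; have := ge k kn; rewrite add0r.
  exists (decode_line (line_word2n u) Hn); split=> //; last exact: decode_lineK.
  apply: (decode_fix (r := to_end n')); first exact: decode_lineK.
    by rewrite /D; case: loopless; rewrite ?dvdn_mull.
  exact: line_word_D.
- set b := encode (to_end n') c.
  pose u := [tuple (b i, b (i + n)%N) | i < n].
  have nu i : (i < n)%N -> nth (false, false) u i = (b i, b (i + n)%N).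
    move=> lt; rewrite -[i]/(nat_of_ord (Ordinal lt)) -tnth_nth tnth_mktuple //.
  have b2 t : b (t + 2 * n)%N = b t by apply: encode2n; apply: to_endDn.
  have b_shift q m : b (m + q * n)%N = if odd q then b (m + n)%N else b m.
    elim: q m => [|q IH] m; first by rewrite addn0.
    by rewrite mulSn addnA IH -addnA addnn -mul2n b2 /=; case: (odd q).
  have ub : line_word u =1 b.
    move=> t; rewrite [in RHS](divn_eq t n) addnC b_shift.
    by rewrite /line_word nu ?ltn_pmod.
  have [Hn Hge _] := line_block ub.
  exists u; last first.
    have := decode_line_encode ub (line_word2n u) Hn.
    by move=> <-.
  apply/andP; split; last first.
    apply/ballotP; rewrite size_tuple add0r -height_line_word // Hn; split=> // k kn.
    by rewrite add0r -height_line_word // Hge.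
  apply/(all_nthP (false, false)) => i; rewrite size_tuple => lt; rewrite nu //.
  rewrite /allowed /=; case es: loopless => //=; apply/eqP.
  rewrite /b /encode covDn (@opens_per _ _ (@to_endDn n')).
  case: ifP => // /negbT hc.
  have [_ hl] := (@fix_twistP _ _ _).1 fc.
  by rewrite -(hl i hc) /D es.
- apply: (@eq_from_tnth _ _) => i; rewrite !(tnth_nth (false, false)).
  have := e i; have := e (i + n)%N; rewrite !line_word_hi // !line_word_lo //.
  by case: (nth _ u i) => ? ?; case: (nth _ v i) => ? ? /= -> ->.
Qed.

End LineWords.

(** * Counting words *)

Definition paths (loopless : bool) (k : nat) (a : int) : nat :=
  #|[set u : k.-tuple (bool * bool) | all (allowed loopless) u && ballot a u]|.

Lemma card_tuple_cons (T : finType) k (P : pred (seq T)) :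
  #|[set u : k.+1.-tuple T | P u]| =
  (\sum_(x : T) #|[set u : k.-tuple T | P (x :: u)]|)%N.
Proof.
have card_sum (U : finType) (Q : pred U) : #|[set u | Q u]| = (\sum_u Q u)%N.
  by rewrite cardsE -sum1_card big_mkcond; apply: eq_bigr => u _; rewrite unfold_in; case: (Q u).
rewrite card_sum (eq_bigr _ (fun x _ => card_sum _ _)) pair_bigA /=.
rewrite (reindex (fun p : T * k.-tuple T => [tuple of p.1 :: p.2])) //=.
exists (fun u : k.+1.-tuple T => (thead u, [tuple of behead u])).
  by move=> [x u] _ /=; rewrite theadE; congr (_, _); apply: val_inj.
by move=> u _; rewrite [u in RHS]tuple_eta; apply: val_inj.
Qed.

Lemma paths0 loopless a : paths loopless 0 a = (a == 0).
Proof.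
rewrite /paths; case: eqP => a0.
  rewrite (_ : [set _ | _] = [set [tuple]]) ?cards1 //.
  by apply/setP => u; rewrite !inE (tuple0 u) eqxx a0.
rewrite (_ : [set _ | _] = set0) ?cards0 //.
by apply/setP => u; rewrite !inE (tuple0 u) /=; apply/eqP.
Qed.

Lemma paths_neg loopless k a : a < 0 -> paths loopless k a = 0%N.
Proof.
move=> a0; rewrite /paths (_ : [set _ | _] = set0) ?cards0 //.
apply/setP => u; rewrite !inE; apply/negP => /andP[_ /ballotP[h _]].
by have := h 0%N (leq0n _); rewrite big_ord0 addr0; lia.
Qed.

Lemma pathsS loopless k (a : nat) :
  paths loopless k.+1 a = (paths loopless k (a%:Z + 1)%R + (~~ loopless).*2 * paths loopless k a
    + paths loopless k (a%:Z - 1)%R)%N.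
Proof.
rewrite {1}/paths (card_tuple_cons _ (fun u => all (allowed loopless) u && ballot a u)) /=.
pose F (x y : bool) := (allowed loopless (x, y) * paths loopless k (a%:Z + step (x, y))%R)%N.
rewrite (eq_bigr (fun p => F p.1 p.2)); last first.
  move=> [x y] _; rewrite /F /paths; case al: (allowed _ _) => /=.
    by rewrite mul1n.
  by rewrite mul0n; apply: eq_card0 => u; rewrite !inE.
rewrite -(pair_bigA _ F) /= !big_bool /F.
have -> : step (true, true) = 1 by [].
have -> : step (true, false) = 0 by [].
have -> : step (false, true) = 0 by [].
have -> : step (false, false) = -1 by [].
rewrite !addr0 /allowed {F}; case: loopless => /=; lia.
Qed.

(** Reading a pair of letters as two half steps, these are the paths with [2 k]
    steps that stay nonnegative at even times; the second binomial coefficient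
    counts their reflections.  Written without subtraction. *)
Lemma paths_full k (a : nat) :
  (paths false k a + 'C(2 * k, k + a + 2) = 'C(2 * k, k + a))%N.
Proof.
have bin2S (m i : nat) : 'C(2 * m.+1, i.+2) =
    ('C(2 * m, i.+2) + 2 * 'C(2 * m, i.+1) + 'C(2 * m, i))%N.
  by rewrite mulnS !addSn add0n !binS; lia.
elim: k a => [|k IH] a.
  by rewrite paths0; case: a => [|a].
rewrite pathsS; case: a => [|a].
  rewrite (@paths_neg _ _ (0 - 1)) //.
  have -> : 0%N%:Z + 1 = 1%N by [].
  case: k IH => [|k] IH; first by rewrite !paths0.
  have e : 'C(2 * k.+1, k) = 'C(2 * k.+1, k.+2).
    by rewrite -(@bin_sub (2 * k.+1) k.+2); [congr ('C(_, _)); lia|lia].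
  have := IH 1%N; have := IH 0%N.
  rewrite !addn0 !addn1 !addn2 !(bin2S k.+1) /=; lia.
have -> : a.+1%:Z - 1 = a by lia.
have -> : a.+1%:Z + 1 = a.+2 by lia.
have := IH a; have := IH a.+1; have := IH a.+2.
by rewrite !addnS !addSn !addn0 !bin2S; lia.
Qed.

(** The same for Dyck path prefixes read backwards, where parity matters. *)
Lemma paths_loopless k (a : nat) :
  (forall j, k + a = 2 * j -> paths true k a + 'C(k, j.+1) = 'C(k, j))%N /\
  (odd (k + a) -> paths true k a = 0)%N.
Proof.
elim: k a => [|k IH] a.
  by rewrite paths0; case: a => [|a]; split=> //; case=> // j; lia.
rewrite pathsS /= mul0n addn0; case: a => [|a].
  rewrite (@paths_neg _ _ (0 - 1)) // !addn0.
  have -> : 0%N%:Z + 1 = 1%N by [].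
  have [h1 h2] := IH 1%N; split.
    move=> [|j] ej; first by lia.
    have := h1 j.+1 ltac:(lia); rewrite !binS.
    have e : 'C(k, j) = 'C(k, j.+1).
      by rewrite -(@bin_sub k j.+1); [congr ('C(_, _)); lia|lia].
    by lia.
  by move=> o; apply: h2; rewrite addn1.
have -> : a.+1%:Z - 1 = a by lia.
have -> : a.+1%:Z + 1 = a.+2 by lia.
have [h1 h2] := IH a; have [h3 h4] := IH a.+2; split.
  move=> [|j] ej; first by lia.
  by have := h1 j ltac:(lia); have := h3 j.+1 ltac:(lia); rewrite !binS; lia.
by move=> o; rewrite h2 ?h4 //; lia.
Qed.

(** * Words for a nontrivial rotation *)
Section RoundWords.
Variables (n' D' h : nat).
Let n := n'.+1.
Let D := D'.+1.
Implicit Type A : {set 'I_D'.+1}.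

Hypothesis h_gt0 : (0 < h)%N.
Hypothesis h_n : (h %| n)%N.
Hypothesis h2n : (2 * h <= n)%N.
(* [h] is the gcd of [D] and [n]; as [D] divides [2 n], the quotient of [D] by
   [h] is 1 or 2, and it is 2 only if the quotient of [n] by [h] is odd. *)
Hypothesis Dh : D = h \/ D = (2 * h)%N /\ exists q, n = (h + q * D)%N.

Definition round_word A (t : nat) : bool := inZp t \in A.

Lemma round_word_D A t : round_word A (t + D) = round_word A t.
Proof. by rewrite /round_word; congr (_ \in A); apply: val_inj; rewrite /= modnDr. Qed.

Lemma round_word_DM A q t : round_word A (t + q * D) = round_word A t.
Proof. by apply: periodicM => k; apply: round_word_D. Qed.

Lemma round_D_2n : (D %| 2 * n)%N.
Proof.
case: Dh => [->|[-> [q ->]]]; first by rewrite dvdn_mull.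
by rewrite dvdn_pmul2l // dvdn_add // mulnA dvdn_mull.
Qed.

Lemma round_h_D : (h %| D)%N.
Proof. by case: Dh => [->|[-> _]] //; rewrite dvdn_mull. Qed.

Lemma round_word2n A t : round_word A (t + 2 * n) = round_word A t.
Proof. by rewrite -(divnK round_D_2n) round_word_DM. Qed.

(** Passing to the antipodal letter is a shift by [h] in both cases: modulo [D],
    [n] is [0] in the first and [h] in the second. *)
Lemma round_word_shift A t : round_word A (t + n) = round_word A (t + h).
Proof.
case: Dh => [Dh'|[_ [q ->]]]; last by rewrite addnA round_word_DM.
by rewrite -(divnK h_n) -Dh' round_word_DM round_word_D.
Qed.

Lemma round_word_weight A t :
  weight n' (round_word A) (t + h) = weight n' (round_word A) t.
Proof.
rewrite /weight !round_word_shift; case: Dh => [<-|[D2 _]].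
  by rewrite !round_word_D.
by rewrite -addnA addnn -mul2n -D2 round_word_D [X in X - 1]addrC.
Qed.

Lemma card_round_word A : #|A|%:Z = \sum_(k < D) (round_word A k)%:Z.
Proof.
rewrite -sum1_card big_mkcond /= (big_morph Posz PoszD (erefl _)).
by apply: eq_bigr => k _; rewrite /round_word valZpK; case: (k \in A).
Qed.

Lemma round_word_height A : height n' (round_word A) h =
  if D == h then 2 * #|A|%:Z - D%:Z else #|A|%:Z - h%:Z.
Proof.
rewrite card_round_word /height /weight.
under eq_bigr do rewrite round_word_shift.
rewrite sumrB big_split /= sumr_const card_ord; case: Dh => [Dh'|[D2 _]].
  rewrite Dh' eqxx -Dh'.
  under [X in _ + X - _ = _]eq_bigr do rewrite round_word_D.
  by rewrite natz; ring.
rewrite ifN; last by lia.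
have -> : D = (h + h)%N by lia.
rewrite big_split_ord /=.
under [X in _ = _ + X - _]eq_bigr do rewrite addnC.
by rewrite natz.
Qed.

Definition round_good A : bool :=
  (2 * #|A| == D)%N || (n == 2 * D)%N && (2 * #|A| == D.+1)%N.

Lemma round_goodP A (H := height n' (round_word A)) :
  reflect (H h = 0 \/ H h = 1 /\ n = (2 * h)%N) (round_good A).
Proof.
apply: (equivP idP); rewrite /H round_word_height /round_good.
case: Dh => [Dh'|[D2 [q nq]]].
  rewrite -Dh' eqxx; split=> [/orP[|/andP[]]|[|[]]]; [left|right|lia|lia]; lia.
rewrite ifN; last by lia.
have n4 : (n == 2 * D)%N = false.
  rewrite nq D2; apply/negP => /eqP e.
  have : (h * (1 + q * 2) = h * 4)%N by lia.
  by move/eqP; rewrite eqn_pmul2l //; lia.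
have n2 : (n == 2 * h)%N = false.
  rewrite nq D2; apply/negP => /eqP e.
  have : (h * (1 + q * 2) = h * 2)%N by lia.
  by move/eqP; rewrite eqn_pmul2l //; lia.
rewrite n4 orbF; split=> [/eqP|[|[_ /eqP]]]; last by rewrite n2.
  by left; lia.
by move=> ?; apply/eqP; lia.
Qed.

Lemma round_word_inj A B : round_word A =1 round_word B -> A = B.
Proof. by move=> e; apply/setP => i; have := e i; rewrite /round_word valZpK. Qed.

Lemma card_fixed_round : #|fixed n D| = #|[set A | round_good A]|.
Proof.
apply: (@card_fixed_words _ _ _ round_word _ (reach h)
  (fun b => (dec_edges n' b h, dec_loops n' b h))) => [A /round_goodP s01|c fc|]; last first.
- exact: round_word_inj.
- have [ha hl] := (@fix_twistP _ _ _).1 fc.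
  have adj_per i j : adj (ncc_val c).1 (i + h) (j + h) = adj (ncc_val c).1 i j.
    case: Dh => [<-|[_ [q nq]]] //.
    have haM x y : adj (ncc_val c).1 (x + q * D) (y + q * D) = adj (ncc_val c).1 x y.
      by elim: q {nq} => [|q IH]; rewrite ?addn0 // mulSn (addnC D) !addnA ha IH.
    by rewrite -haM -!addnA -nq adjD.
  set b := encode (reach h) c.
  have bD t : b (t + D)%N = b t.
    rewrite /b /encode (cov_per ha); case: ifP => [_|/negbT/hl //].
    by apply: eq_existsb => k; rewrite addnAC ha.
  pose A := [set i : 'I_D | b i].
  have Ab : round_word A =1 b.
    move=> t; rewrite /round_word inE [in RHS](divn_eq t D) addnC.
    by rewrite (periodicM bD).
  have s01 : round_good A by apply/round_goodP; apply: (round_s h_gt0 h_n h2n adj_per Ab).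
  exists A => //.
  have Hper := height_per (round_word_weight A).
  have := decode_round_encode h_gt0 h_n h2n adj_per Ab (round_word2n A) Hper.
  by move=> /(_ (round_goodP _ s01)) <-.
have Hper := height_per (round_word_weight A).
exists (decode Hper h_gt0 h_n s01).
have dK := decode_roundK h_gt0 h_n h2n (round_word2n A) Hper s01.
split=> //; apply: (decode_fix dK); first exact: round_h_D.
exact: round_word_D.
Qed.

End RoundWords.

Lemma card_set_size (D k : nat) : #|[set A : {set 'I_D} | #|A| == k]| = 'C(D, k).
Proof. by rewrite card_draws card_ord. Qed.

(** * Comparison with the values at roots of unity *)

Lemma fixed_all n : (0 < n)%N -> (#|fixed n (2 * n)| + 'C(2 * n, n + 2) = 'C(2 * n, n))%N.
Proof.
case: n => // n' _; rewrite (card_fixed_line n' false).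
by have := paths_full n'.+1 0; rewrite addn0.
Qed.

Lemma fixed_half n : (0 < n)%N ->
  (forall j, n = 2 * j -> #|fixed n n| + 'C(n, j.+1) = 'C(n, j))%N /\
  (odd n -> #|fixed n n| = 0)%N.
Proof.
case: n => // n' _; rewrite (card_fixed_line n' true).
by have := paths_loopless n'.+1 0; rewrite addn0.
Qed.

(** [D / gcd(D, n)] is coprime to [n / gcd(D, n)] and divides twice it. *)
Lemma fixed_round n D : (0 < D < n)%N -> (D %| 2 * n)%N ->
  #|fixed n D| = #|[set A : {set 'I_D} |
    (2 * #|A| == D)%N || (n == 2 * D)%N && (2 * #|A| == D.+1)%N]|.
Proof.
case: n D => [|n'] [|D'] // Dn D2.
set n := n'.+1 in Dn D2 *; set D := D'.+1 in Dn D2 *.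
pose h := gcdn D n.
have h0 : (0 < h)%N by rewrite gcdn_gt0.
have hD : (h %| D)%N := dvdn_gcdl _ _; have hn : (h %| n)%N := dvdn_gcdr _ _.
have [d ed] := dvdnP hD; have [m em] := dvdnP hn.
have cop : coprime d m.
  rewrite /coprime -(eqn_pmul2r h0) muln_gcdl -ed -em mul1n //.
have d2 : (d %| 2)%N.
  by move: D2; rewrite ed em mulnA dvdn_pmul2r // Gauss_dvdl.
have [d1|d1] : d = 1%N \/ d = 2%N by have := dvdn_leq _ d2; case: d {ed cop} d2 => [|[|[]]] //; auto.
  apply: (card_fixed_round (h := h)) => //; last by left; rewrite -/D ed d1 mul1n.
  have : (h * 1 < h * m)%N by lia.
  by rewrite ltn_pmul2l // -/n em => m1; rewrite leq_mul2r m1 orbT.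
apply: (card_fixed_round (h := h)) => //; first by rewrite -/n; lia.
right; rewrite -/D -/n; split; first by lia.
have om : odd m by move: cop; rewrite d1 coprime2n.
by exists m./2; have := odd_double_half m; rewrite om; nia.
Qed.

Lemma iter_fix_mul (T : Type) (f : T -> T) k q x : iter k f x = x -> iter (q * k) f x = x.
Proof. by move=> e; elim: q => // q IH; rewrite mulSn iterD IH. Qed.

Lemma eq_fixed n a b :
  (forall c, iter a (@twist n) c = c <-> iter b (@twist n) c = c) ->
  fixed n a = fixed n b.
Proof.
move=> ab; apply/setP => c.
have e : (iter a (@twist n) c == c) = (iter b (@twist n) c == c).
  by apply/eqP/eqP => /ab.
exact: (etrans (in_fixed a c) (etrans e (esym (in_fixed b c)))).
Qed.

(** The twist to the power [2 n] is the identity, so Bezout applies. *)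
Lemma fixed_gcd n a : (0 < a)%N -> fixed n a = fixed n (gcdn a (2 * n)).
Proof.
move=> a0; apply: eq_fixed => c; split=> e.
  have [u v uv _] := egcdnP (2 * n) a0.
  rewrite -[RHS](iter_fix_mul u e) uv addnC iterD.
  by rewrite (iter_fix_mul v (twist_order c)).
by have /dvdnP[q ->] := dvdn_gcdl a (2 * n); apply: iter_fix_mul.
Qed.

Lemma fixed_mod n a : fixed n (a %% (2 * n)) = fixed n a.
Proof.
apply: eq_fixed => c; rewrite {2}(divn_eq a (2 * n)) addnC iterD.
by rewrite (iter_fix_mul _ (twist_order c)).
Qed.

Section Eval.
Variables (n D e : nat) (w : algC).
Hypothesis n_gt0 : (0 < n)%N.
Hypothesis De : (D * e = 2 * n)%N.
Hypothesis pw : e.-primitive_root w.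

Let f : {poly int} := qbinom (2 * n)%N n - 'X^2 * qbinom (2 * n)%N (n%:Z - 2).

Lemma qev_sieve : (map_poly intr f).[w] =
  qbinom_at w (2 * n) n - w ^+ 2 * (if (2 <= n)%N then qbinom_at w (2 * n) (n - 2) else 0).
Proof.
rewrite /f rmorphB /= hornerD hornerN rmorphM /= hornerM map_polyXn hornerXn.
rewrite /qbinom_at /qev; congr (_ - _ * _).
case: ifP => [n2|/negbT n1]; first by rewrite subzn.
have -> : n = 1%N by lia.
by rewrite [qbinom _ _](_ : _ = 0) // rmorph0 hornerC.
Qed.

Lemma qbinom_at_sieve r : qbinom_at w (2 * n) r = if (e %| r)%N then 'C(D, r %/ e)%:R else 0.
Proof. by rewrite -De qbinom_lucas. Qed.

Lemma fixed_eval : #|fixed n D|%:R = (map_poly intr f).[w].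
Proof.
have e0 : (0 < e)%N := prim_order_gt0 pw.
rewrite qev_sieve !qbinom_at_sieve.
case: (ltngtP e 1) => [|e3|e1]; first by lia.
  case: (ltngtP e 2) => [|{}e3|e2]; first by lia.
    have Dn : (0 < D < n)%N by nia.
    have D2 : (D %| 2 * n)%N by rewrite -De dvdn_mulr.
    rewrite (fixed_round Dn D2); have -> : (1 < n)%N by lia.
    have := odd_double_half D; move: (D./2) => j; case: (odd D) => ej.
      (* For odd [D] the order is even, [e = 2 m], and [n = m] modulo [e]: the
         first coefficient vanishes, and the second unless [m = 2]. *)
      have dn : (e %| n)%N = false.
        apply/negP => /dvdnP[q nq].
        have : (e * D = e * (2 * q))%N by lia.
        by move/eqP; rewrite eqn_pmul2l //; lia.
      rewrite dn sub0r.
      have [m em] : exists m, e = (2 * m)%N.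
        have : (2 %| D * e)%N by rewrite De dvdn_mulr.
        rewrite Gauss_dvdr; last by rewrite coprime2n -ej oddD odd_double.
        by case/dvdnP => m ->; exists m; rewrite mulnC.
      have nm : n = (j * e + m)%N by nia.
      have dn2 : (e %| n - 2)%N = (m == 2)%N.
        have -> : (n - 2 = j * e + (m - 2))%N.
          by rewrite [in LHS]nm addnBA //; lia.
        rewrite dvdn_addr ?dvdn_mull //; case: eqP => m2; first by rewrite m2 dvdn0.
        by apply/negP => /dvdn_leq; lia.
      rewrite dn2; case: (m =P 2%N) => m2.
        have e4 : e = 4%N by lia.
        have w2 : w ^+ 2 = -1.
          have : (w ^+ 2) ^+ 2 = 1 by rewrite -exprM -(prim_expr_order pw) e4.
          move/eqP; rewrite sqrf_eq1 => /orP[|/eqP //].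
          by rewrite -(prim_order_dvd pw) e4.
        rewrite w2 mulN1r opprK; congr (_ %:R).
        have -> : ((n - 2) %/ e = D - j.+1)%N.
          have -> : (n - 2 = j * e)%N by lia.
          by rewrite mulnK //; lia.
        rewrite bin_sub; last by lia.
        rewrite -card_set_size; apply: eq_card => A; rewrite !inE.
        by apply/idP/idP; lia.
      rewrite mulr0 oppr0.
      rewrite eq_card0 // => A; rewrite !inE; apply/negP.
      have : n <> (2 * D)%N by nia.
      lia.
    (* For even [D] the order divides [n], hence not [n - 2] as [2 < e]. *)
    have nj : n = (j * e)%N by nia.
    have -> : (e %| n)%N by rewrite nj dvdn_mull.
    have -> : (e %| n - 2)%N = false.
      apply/negP => h; have : (e %| 2)%N.
        by rewrite -(@dvdn_addr (n - 2)) // subnK ?nj ?dvdn_mull //; nia.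
      by move/dvdn_leq; lia.
    rewrite mulr0 subr0 nj mulnK // -card_set_size; congr (_ %:R).
    by apply: eq_card => A; rewrite !inE; apply/idP/idP; lia.
  have -> : D = n by lia.
  have [h1 h2] := fixed_half n_gt0.
  have w2 : w ^+ 2 = 1 by rewrite -[2%N]e2 (prim_expr_order pw).
  rewrite w2 mul1r e2; have := odd_double_half n; move: (n./2) => j; case o: (odd n) => ej.
    rewrite h2 //; have -> : (2 %| n)%N = false by rewrite dvdn2 o.
    case: ifP => n2; last by rewrite subrr.
    by rewrite dvdn_subl // dvdn2 o subrr.
  have := h1 j ltac:(lia) => h; rewrite dvdn2 o /=.
  have -> : (n %/ 2 = j)%N by lia.
  have -> : (1 < n)%N by lia.
  have -> : (2 %| n - 2)%N by rewrite dvdn_subl ?dvdn2 ?o //; lia.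
  have -> : 'C(n, (n - 2) %/ 2) = 'C(n, j.+1).
    by rewrite -(@bin_sub n j.+1); [congr 'C(_, _); lia | lia].
  by rewrite -h natrD addrK.
subst e; have -> : D = (2 * n)%N by lia.
have w1 : w = 1 by have := prim_expr_order pw; rewrite expr1.
rewrite w1 expr1n mul1r !dvd1n !divn1 -(fixed_all n_gt0) natrD.
case: ifP => n2.
  have -> : 'C(2 * n, n - 2) = 'C(2 * n, n + 2).
    by rewrite -(@bin_sub (2 * n) (n + 2)); [congr 'C(_, _); lia | lia].
  by rewrite addrK.
by rewrite subr0 (@bin_small _ (n + 2)) ?addr0 //; lia.
Qed.

End Eval.

Section Action.
Variable n : nat.
Hypothesis n_gt0 : (0 < n)%N.

Let n2 : (1 < 2 * n)%N. Proof. lia. Qed.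
Let to := twist_action n.

Lemma val_expg (k : nat) :
  nat_of_ord ((1%R : 'Z_(2 * n)) ^+ k)%g = (k %% (2 * n))%N.
Proof. by rewrite Zp_expg /= mul1n Zp_cast. Qed.

(** A positive exponent [a] congruent to [d] modulo [2 n] serves for both
    sides. *)
Lemma fix_expgz (d : int) : exists2 a : nat, (0 < a)%N &
  ('Fix_to[expgz (1%R : 'Z_(2 * n)) d])%g = fixed n a /\
  forall xi : algC, (2 * n).-primitive_root xi -> xi ^ d = xi ^+ a.
Proof.
have fixE (z : 'Z_(2 * n)) : ('Fix_to[z])%g = fixed n z.
  by apply/setP => c; rewrite in_fixed; apply/afix1P/eqP.
case: d => k.
  exists (k + 2 * n)%N; first by lia.
  split=> [|xi p]; last by rewrite exprD (prim_expr_order p) mulr1.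
  by rewrite fixE /= val_expg -[in RHS]fixed_mod modnDr.
exists (2 * n * k.+2 - k.+1)%N; first by nia.
have le : (k.+1 <= 2 * n * k.+2)%N by nia.
split=> [|xi p]; last first.
  have xi0 : xi ^+ k.+1 != 0 by rewrite expf_neq0 // (prim_root_eq0 p) -lt0n ltnW.
  rewrite NegzE; apply: (mulIf xi0).
  by rewrite -exprD subnK // exprM (prim_expr_order p) expr1n mulVf.
rewrite fixE /= val_expg -[in RHS]fixed_mod; congr (fixed n _).
rewrite Zp_cast //; apply/eqP; rewrite -(eqn_modDr k.+1) subnK //.
have -> : (2 * n - k.+1 %% (2 * n) + k.+1 = 2 * n * (k.+1 %/ (2 * n)).+1)%N.
  rewrite [in X in (_ + X)%N](divn_eq k.+1 (2 * n)).
  by have := ltn_pmod k.+1 (ltnW n2); lia.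
by rewrite !modnMr.
Qed.

End Action.

Theorem theorem4 (n : nat) (hn : (1 <= n)%N) :
  @cyclic_sieving 'Z_(2 * n) [set: 'Z_(2 * n)]%G (ncc n) (twist_action n)
    (1%R : 'Z_(2 * n)) (2 * n)%N
    (qbinom (2 * n)%N n - 'X^2 * qbinom (2 * n)%N (n%:Z - 2)).
Proof.
have n2 : (1 < 2 * n)%N by lia.
split.
- exact: (Zp_cycle (Zp_trunc (2 * n)).+1).
- by rewrite (order_Zp1 (Zp_trunc (2 * n)).+1) Zp_cast.
- exact: sieve_ge0.
move=> xi pxi d; have [a a0 [-> /(_ xi pxi) ->]] := fix_expgz hn d.
rewrite fixed_gcd //.
have Dgt : (0 < gcdn a (2 * n))%N by rewrite gcdn_gt0 a0.
apply: (@fixed_eval n _ (2 * n %/ gcdn a (2 * n))) => //.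
  by rewrite mulnC divnK // dvdn_gcdr.
exact: exp_prim_root.
Qed.
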